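(* Let $V$ be a pure isometric representation of $P$ on a separable Hilbert space $K$, and for $x\in P$ put $K_x=\ker(V_x^* )$. Suppose $V$ is proper, that is, there exist $x,y\in P$ such that, writing $L=V_x(K_y)\cap V_y(K_x)$, $$V_x(K_y)\cap L^\perp\neq\{0\},\qquad V_y(K_x)\cap L^\perp\neq\{0\},\qquad \bigl(V_x(K_y)\cap L^\perp\bigr)\perp\bigl(V_y(K_x)\cap L^\perp\bigr).$$ Then the CCR flow $\alpha$ associated with $V$ is not cocycle conjugate to the CAR flow $\beta$ associated with $V$.
   Context: $P\subset\mathbb{R}^d$ is a closed convex cone that is spanning ($P-P=\mathbb{R}^d$) and pointed ($P\cap -P=\{0\}$), with interior $\mathrm{int}(P)$. Hilbert spaces are complex and separable, with inner products linear in the second variable. An isometric representation of $P$ on $K$ is a strongly continuous semigroup $V=\{V_x:x\in P\}$ of isometries on $K$; it is pure if $\bigcap_{t\ge0}V_{ta}(K)=\{0\}$ for all $a\in\mathrm{int}(P)$. An $E_0$-semigroup over $P$ on $B(H)$ is a family $\alpha=\{\alpha_x:x\in P\}$ of normal unital $*$-endomorphisms of $B(H)$ with $\alpha_x\circ\alpha_y=\alpha_{x+y}$, $\alpha_0=\mathrm{id}$, and $x\mapsto\langle\alpha_x(A)\xi,\eta\rangle$ continuous for all $A\in B(H)$, $\xi,\eta\in H$. An $\alpha$-cocycle is a strongly continuous family of unitaries $\{U_x\}_{x\in P}$ in $B(H)$ with $U_x\alpha_x(U_y)=U_{x+y}$ for all $x,y\in P$; the cocycle perturbation of $\alpha$ by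 it is $\{\mathrm{Ad}(U_x)\circ\alpha_x\}$. $E_0$-semigroups $\alpha$ on $B(H)$ and $\beta$ on $B(H')$ are cocycle conjugate if there is a unitary $U:H\to H'$ such that $\{\mathrm{Ad}(U)\circ\alpha_x\circ\mathrm{Ad}(U^* )\}_{x\in P}$ is a cocycle perturbation of $\beta$. $\Gamma_s(K)=\bigoplus_{n\ge0}K^{\vee n}$ is the symmetric Fock space, with exponential vectors $e(u)=\sum_n u^{\otimes n}/\sqrt{n!}$ and Weyl unitaries determined by $W(u)e(v)=e^{-\|u\|^2/2-\langle u,v\rangle}e(u+v)$. The CCR flow of $V$ is the unique $E_0$-semigroup $\alpha$ on $B(\Gamma_s(K))$ with $\alpha_x(W(u))=W(V_xu)$ for all $x\in P$, $u\in K$. $\Gamma_a(K)=\bigoplus_{n\ge0}K^{\wedge n}$ is the antisymmetric Fock space; $a^*(f)$ is the Fermionic creation operator ($a^*(f)\xi=f\wedge\xi$, with $a^*(f)$ applied to the vacuum equal to $f$) and $a(f)=a^*(f)^*$. The CAR flow of $V$ is the unique $E_0$-semigroup $\beta$ on $B(\Gamma_a(K))$ with $\beta_x(a(u))=a(V_xu)$ for all $x\in P$, $u\in K$. *)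

(* Defs.v *)
From HB Require Import structures.
From mathcomp Require Import all_boot all_order all_algebra all_fingroup.
From mathcomp Require Import complex.
From mathcomp Require Import all_classical all_reals all_analysis.

Set Implicit Arguments.
Unset Strict Implicit.
Unset Printing Implicit Defensive.

Import Order.TTheory GRing.Theory Num.Theory.
Import numFieldNormedType.Exports.

Local Open Scope classical_set_scope.
Local Open Scope ring_scope.
Local Open Scope complex_scope.

Section Cones.
Context {R : realType} {d : nat}.
Implicit Type P : set 'rV[R]_d.

Definition closed_convex_cone P : Prop :=
  [/\ closed P, P 0,
      (forall x y, P x -> P y -> P (x + y)) &
      (forall (t : R) x, 0 <= t -> P x -> P (t *: x))].

Definition spanning P : Prop :=
  forall z, exists x y, [/\ P x, P y & z = x - y].

Definition pointed_cone P : Prop := forall x, P x -> P (- x) -> x = 0.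

End Cones.

HB.mixin Record isHilbert (R : realType) (H : Type)
    of CompleteNormedModule R[i] H := {
  dotp : H -> H -> R[i] ;
  dotpDr : forall x y z, dotp x (y + z) = dotp x y + dotp x z ;
  dotpZr : forall (a : R[i]) x y, dotp x (a *: y) = a * dotp x y ;
  dotp_conj : forall x y, dotp y x = (dotp x y)^* ;
  dotp_norm : forall x, dotp x x = `|x| ^+ 2
}.

#[short(type="hilbertType")]
HB.structure Definition Hilbert (R : realType) :=
  {H of CompleteNormedModule R[i] H & isHilbert R H}.

Definition separable (T : topologicalType) : Prop :=
  exists2 A : set T, countable A & dense A.

Section HilbertSpace.
Context {R : realType} {H : hilbertType R}.
Implicit Type S : set H.

Definition orthocompl S : set H := [set x | forall y, S y -> dotp y x = 0].

Definition orthogonal_sets (S T : set H) : Prop :=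
  forall x y, S x -> T y -> dotp x y = 0.

Definition lspan S : set H :=
  [set x | exists n (c : 'I_n -> R[i]) (v : 'I_n -> H),
     (forall i, S (v i)) /\ x = \sum_(i < n) c i *: v i].

End HilbertSpace.

Record bop (R : realType) (H H' : hilbertType R) := Bop {
  bop_fun :> H -> H' ;
  bop_linear : linear bop_fun ;
  bop_continuous : continuous bop_fun
}.
Arguments bop_linear {R H H'} b.
Arguments bop_continuous {R H H'} b.

Notation "''B' ( H )" := (bop H H) (at level 8, format "''B' ( H )").

Section BopStructure.
Context {R : realType} {H H' : hilbertType R}.
Implicit Types A B C : bop H H'.

HB.instance Definition _ A :=
  GRing.isLinear.Build R[i] H H' *:%R (bop_fun A) (bop_linear A).

Lemma bopP A B : A =1 B -> A = B.
Proof.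
case: A B => [f fl fc] [g gl gc] /= /funext fg; subst g.
by congr Bop; exact: Prop_irrelevance.
Qed.

HB.instance Definition _ := gen_eqMixin (bop H H').
HB.instance Definition _ := gen_choiceMixin (bop H H').

Lemma bop0_linear : linear (fun _ : H => 0 : H').
Proof. by move=> a x y; rewrite scaler0 addr0. Qed.
Lemma bop0_continuous : continuous (fun _ : H => 0 : H').
Proof. exact: cst_continuous. Qed.
Definition bop0 := Bop bop0_linear bop0_continuous.

Lemma bopD_linear A B : linear (fun x => A x + B x).
Proof. by move=> a x y; rewrite !linearP/= scalerDr addrACA. Qed.
Lemma bopD_continuous A B : continuous (fun x => A x + B x).
Proof. by move=> x; apply: cvgD; exact: bop_continuous. Qed.
Arguments bopD_continuous : clear implicits.
Definition bopD A B := Bop (bopD_linear A B) (bopD_continuous A B).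

Lemma bopZ_linear (a : R[i]) A : linear (fun x => a *: A x).
Proof. by move=> b x y; rewrite linearP/= scalerDr !scalerA mulrC. Qed.
Lemma bopZ_continuous (a : R[i]) A : continuous (fun x => a *: A x).
Proof. by move=> x; apply: cvgZl_tmp; exact: bop_continuous. Qed.
Arguments bopZ_continuous : clear implicits.
Definition bopZ (a : R[i]) A := Bop (bopZ_linear a A) (bopZ_continuous a A).

Lemma bopDA : associative bopD.
Proof. by move=> A B C; apply: bopP => x /=; rewrite addrA. Qed.
Lemma bopDC : commutative bopD.
Proof. by move=> A B; apply: bopP => x /=; rewrite addrC. Qed.
Lemma bop0D : left_id bop0 bopD.
Proof. by move=> A; apply: bopP => x /=; rewrite add0r. Qed.
Lemma bopND : left_inverse bop0 (bopZ (-1)) bopD.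
Proof. by move=> A; apply: bopP => x /=; rewrite scaleN1r addNr. Qed.

HB.instance Definition _ :=
  GRing.isZmodule.Build (bop H H') bopDA bopDC bop0D bopND.

Lemma bopZA a b A : bopZ a (bopZ b A) = bopZ (a * b) A.
Proof. by apply: bopP => x /=; rewrite scalerA. Qed.
Lemma bopZ1 : left_id 1 bopZ.
Proof. by move=> A; apply: bopP => x /=; rewrite scale1r. Qed.
Lemma bopZDr : right_distributive bopZ +%R.
Proof. by move=> a A B; apply: bopP => x /=; rewrite scalerDr. Qed.
Lemma bopZDl A : {morph bopZ^~ A : a b / a + b}.
Proof. by move=> a b; apply: bopP => x /=; rewrite scalerDl. Qed.

HB.instance Definition _ :=
  GRing.Zmodule_isLmodule.Build R[i] (bop H H') bopZA bopZ1 bopZDr bopZDl.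

End BopStructure.

Section BopComp.
Context {R : realType}.
Implicit Types H : hilbertType R.

Lemma bop1_linear H : linear (@idfun H).
Proof. by []. Qed.
Lemma bop1_continuous H : continuous (@idfun H).
Proof. by move=> x; exact: cvg_id. Qed.
Arguments bop1_continuous : clear implicits.
Definition bop1 {H} : 'B(H) := Bop (@bop1_linear H) (@bop1_continuous H).

Lemma bopM_linear H1 H2 H3 (A : bop H2 H3) (B : bop H1 H2) : linear (A \o B).
Proof. by move=> a x y /=; rewrite !linearP. Qed.
Lemma bopM_continuous H1 H2 H3 (A : bop H2 H3) (B : bop H1 H2) :
  continuous (A \o B).
Proof. by move=> x; apply: continuous_comp; exact: bop_continuous. Qed.
Arguments bopM_continuous {H1 H2 H3} A B.
Definition bopM H1 H2 H3 (A : bop H2 H3) (B : bop H1 H2) : bop H1 H3 :=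
  Bop (bopM_linear A B) (bopM_continuous A B).

End BopComp.

Notation "A \* B" := (bopM A B) (at level 40, left associativity).

Section Operators.
Context {R : realType}.
Implicit Types H : hilbertType R.

(* Exists and is unique by the Riesz representation theorem, so the default
   value of [xget] is never taken. *)
Definition adj {H H'} (A : bop H H') : bop H' H :=
  xget 0 [set B : bop H' H | forall x y, dotp (A x) y = dotp x (B y)].

Definition isometry {H H'} (A : bop H H') : Prop :=
  forall x, `|A x| = `|x|.

Definition unitary {H H'} (U : bop H H') : Prop :=
  adj U \* U = bop1 /\ U \* adj U = bop1.

Definition conjugation {H H'} (U : bop H H') (A : 'B(H)) : 'B(H') :=
  U \* A \* adj U.

(* The order of [R[i]] compares numbers with equal imaginary part, hence
   [bop_le A B] says that [B - A] is a positive operator. *)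
Definition bop_le {H} (A B : 'B(H)) : Prop :=
  forall x, dotp x (A x) <= dotp x (B x).

Definition is_bop_lub {H} (D : set 'B(H)) (S : 'B(H)) : Prop :=
  (forall A, D A -> bop_le A S) /\
  (forall T, (forall A, D A -> bop_le A T) -> bop_le S T).

Definition directed {H} (D : set 'B(H)) : Prop :=
  D !=set0 /\
  forall A B, D A -> D B -> exists2 C, D C & bop_le A C /\ bop_le B C.

Definition normal_map {H H'} (phi : 'B(H) -> 'B(H')) : Prop :=
  forall (D : set 'B(H)) (S : 'B(H)),
    (forall A, D A -> bop_le 0 A) -> directed D -> is_bop_lub D S ->
    is_bop_lub (phi @` D) (phi S).

Record normal_unital_star_endo {H} (phi : 'B(H) -> 'B(H)) : Prop := {
  endo_linear : linear phi ;
  endo_mul : forall A B, phi (A \* B) = phi A \* phi B ;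
  endo_adj : forall A, phi (adj A) = adj (phi A) ;
  endo_unital : phi bop1 = bop1 ;
  endo_normal : normal_map phi
}.

End Operators.

(* Families indexed by [P] are functions on R^d whose values outside [P] are
   irrelevant. *)

Section Semigroups.
Context {R : realType} {d : nat} (P : set 'rV[R]_d).
Implicit Types H K : hilbertType R.

Definition strongly_continuous {H H'} (T : 'rV[R]_d -> bop H H') : Prop :=
  forall xi, {within P, continuous (fun x => T x xi)}.

Record isometric_rep {K} (V : 'rV[R]_d -> 'B(K)) : Prop := {
  rep_isometry : forall x, P x -> isometry (V x) ;
  rep0 : V 0 = bop1 ;
  repD : forall x y, P x -> P y -> V (x + y) = V x \* V y ;
  rep_continuous : strongly_continuous V
}.

Definition pure {K} (V : 'rV[R]_d -> 'B(K)) : Prop :=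
  forall a, (interior P) a ->
    \bigcap_(t in [set t : R | 0 <= t]) range (V (t *: a)) = [set 0].

Definition defect_space {K} (V : 'rV[R]_d -> 'B(K)) (x : 'rV[R]_d) : set K :=
  [set xi | adj (V x) xi = 0].

Definition proper_rep {K} (V : 'rV[R]_d -> 'B(K)) : Prop :=
  exists x y, [/\ P x, P y &
    let A := V x @` defect_space V y in
    let B := V y @` defect_space V x in
    let L := A `&` B in
    [/\ A `&` orthocompl L <> [set 0],
        B `&` orthocompl L <> [set 0] &
        orthogonal_sets (A `&` orthocompl L) (B `&` orthocompl L)]].

Record E0_semigroup {H} (alpha : 'rV[R]_d -> 'B(H) -> 'B(H)) : Prop := {
  E0_endo : forall x, P x -> normal_unital_star_endo (alpha x) ;
  E0_add : forall x y, P x -> P y ->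
    forall A, alpha x (alpha y A) = alpha (x + y) A ;
  E0_0 : forall A, alpha 0 A = A ;
  E0_continuous : forall A xi eta,
    {within P, continuous (fun x => dotp (alpha x A xi) eta : R[i]^o)}
}.

Record cocycle {H} (alpha : 'rV[R]_d -> 'B(H) -> 'B(H))
    (U : 'rV[R]_d -> 'B(H)) : Prop := {
  cocycle_unitary : forall x, P x -> unitary (U x) ;
  cocycle_mul : forall x y, P x -> P y -> U x \* alpha x (U y) = U (x + y) ;
  cocycle_continuous : strongly_continuous U
}.

Definition cocycle_perturbation {H}
    (beta alpha : 'rV[R]_d -> 'B(H) -> 'B(H)) : Prop :=
  exists2 U, cocycle alpha U &
    forall x, P x -> forall A, beta x A = conjugation (U x) (alpha x A).

Definition cocycle_conjugate {H H'} (alpha : 'rV[R]_d -> 'B(H) -> 'B(H))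
    (beta : 'rV[R]_d -> 'B(H') -> 'B(H')) : Prop :=
  exists2 U : bop H H', unitary U &
    cocycle_perturbation
      (fun x A => conjugation U (alpha x (conjugation (adj U) A))) beta.

End Semigroups.

(* As for every Hilbert tensor product, a Fock space over [K] is given by a
   Hilbert space together with its decomposable vectors, and is determined by
   these data up to a unique unitary: the decomposable vectors are total and
   their inner products are prescribed, vectors of different degree being
   orthogonal. A sequence [[:: u1; ...; un]] stands for the decomposable vector
   of degree [n] with factors [u1, ..., un]; [[::]] gives the vacuum.
   Multilinearity and (anti)symmetry in the factors follow from the formula for
   the inner products. *)

Section Gram.
Context {R : realType} {K : hilbertType R}.
Implicit Types s t : seq K.

(* u1 \/ ... \/ un is the orthogonal projection of u1 (x) ... (x) un onto the
   symmetric tensors, so that u \/ ... \/ u is the n-th tensor power of u. *)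
Definition sym_gram s t : R[i] :=
  if size s == size t then
    ((size s)`!%:R)^-1 *
    \sum_(p : 'S_(size s)) \prod_(i < size s) dotp s`_i t`_(p i)
  else 0.

(* u1 /\ ... /\ un is (n!)^(-1/2) times the signed sum of the permuted tensors
   u_p(1) (x) ... (x) u_p(n); with this normalization f |-> f /\ - satisfies
   the canonical anticommutation relations. *)
Definition alt_gram s t : R[i] :=
  if size s == size t then
    \det (\matrix_(i < size s, j < size s) dotp s`_i t`_j)
  else 0.

End Gram.

Record symFock (R : realType) (K : hilbertType R) := SymFock {
  symFock_space :> hilbertType R ;
  vee : seq K -> symFock_space ;
  vee_dotp : forall s t, dotp (vee s) (vee t) = sym_gram s t ;
  vee_total : dense (lspan (range vee))
}.

Record altFock (R : realType) (K : hilbertType R) := AltFock {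
  altFock_space :> hilbertType R ;
  wedge : seq K -> altFock_space ;
  wedge_dotp : forall s t, dotp (wedge s) (wedge t) = alt_gram s t ;
  wedge_total : dense (lspan (range wedge))
}.

Arguments vee {R K} s : rename.
Arguments wedge {R K} a : rename.

Definition cexp {R : realType} (z : R[i]) : R[i] :=
  (expR (complex.Re z))%:C * (cos (complex.Im z) +i* sin (complex.Im z)).

Section CCR.
Context {R : realType} {K : hilbertType R} (G : symFock K).

Definition exp_vector (u : K) : G :=
  limn (series (fun n => ((Num.sqrt (n`!%:R : R))^-1)%:C *: vee G (nseq n u))).

(* The defining condition of [weyl u], and that of [creation f] below, is
   satisfied by exactly one bounded operator, so that the default value of
   [xget] is never taken. *)
Definition weyl (u : K) : 'B(G) :=
  xget 0 [set T : 'B(G) | unitary T /\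
    forall v, T (exp_vector v) =
      cexp (- (`|u| ^+ 2 / 2) - dotp u v) *: exp_vector (u + v)].

Definition CCR_flow {d : nat} (P : set 'rV[R]_d) (V : 'rV[R]_d -> 'B(K))
    (alpha : 'rV[R]_d -> 'B(G) -> 'B(G)) : Prop :=
  E0_semigroup P alpha /\
  forall x u, P x -> alpha x (weyl u) = weyl (V x u).

End CCR.

Section CAR.
Context {R : realType} {K : hilbertType R} (G : altFock K).

Definition creation (f : K) : 'B(G) :=
  xget 0 [set T : 'B(G) | forall s, T (wedge G s) = wedge G (f :: s)].

Definition annihilation (f : K) : 'B(G) := adj (creation f).

Definition CAR_flow {d : nat} (P : set 'rV[R]_d) (V : 'rV[R]_d -> 'B(K))
    (beta : 'rV[R]_d -> 'B(G) -> 'B(G)) : Prop :=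
  E0_semigroup P beta /\
  forall x u, P x -> beta x (annihilation u) = annihilation (V x u).

End CAR.

(* Main.v *)
(* With x and y as in the definition of properness, say that an E0-semigroup
   gamma on B(H) has property I if the relative commutants of
   ran(gamma_x) /\ ran(gamma_y) in ran(gamma_x) and in ran(gamma_y) commute
   with each other. This is invariant under cocycle conjugacy, since
   U_x ran(gamma_x) U_x^* = U_(x+y) ran(gamma_x) U_(x+y)^* for a cocycle U.

   Let p and q be the projections onto ran V_x and ran V_y. Properness says
   that pq = qp and gives nonzero vectors xi in ran p(1-q), eta in ran q(1-p).

   The CCR flow has I: an operator of the first relative commutant commutes with
   W(u) for u in ker p and for u in ran pq, hence for all u orthogonal to
   E = ran p(1-q), while one of the second commutes with W(u) for u in E, as E
   is contained in ker q. In Gamma(E) (x) Gamma(E^perp) they therefore act on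
   different factors.

   The CAR flow does not have I: if Gam is the parity operator, the operators
   a^*(xi) beta_x(Gam) and a^*(eta) beta_y(Gam) lie in the two relative
   commutants, and their two products map the vacuum to the same nonzero
   multiple of xi /\ eta and of eta /\ xi, respectively. *)

From HB Require Import structures.
From mathcomp Require Import all_boot all_order all_algebra all_fingroup.

Set Implicit Arguments.
Unset Strict Implicit.
Unset Printing Implicit Defensive.

Import Order.TTheory GRing.Theory Num.Theory.
Local Open Scope ring_scope.

(** The obstacle is that ran(gamma_x) /\ ran(gamma_y) is not given by generators. An operator that
    commutes with the images of an irreducible family under a normal endomorphism commutes with the
    whole range ([endo_commutant]); normality enters through the directed family of finite-rank
    projections. For the CAR flow, each of the two operators is then written as a product of an
    operator commuting with one range and an operator commuting with the other, so it commutes with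
    every common element, whatever the intersection is. For the CCR flow, the tensor splitting of
    the Fock space is never built. Commutants of Weyl operators are controlled by matrix elements
    between exponential vectors: such an element is both holomorphic and antiholomorphic in a
    complex parameter, hence constant. The same fact gives the irreducibility of the Weyl
    operators. *)

(** * Permanents as signed sums over subsets *)

Section Ryser.
Context {F : comNzRingType}.

(** For an element [d] of [D], the subsets containing [d] cancel against the others. *)
Lemma sum_sign_subsets (T : finType) (D : {set T}) :
  \sum_(C : {set T} | C \subset D) (-1) ^+ #|C| = (D == set0)%:R :> F.
Proof.
have [->|/set0Pn[d dD]] := eqVneq D set0.
  rewrite (big_pred1 set0) ?cards0 ?expr0 // => C; exact: subset0.
rewrite (bigID (fun C : {set T} => d \in C)) /=.
rewrite (reindex_onto (fun C => d |: C) (fun C => C :\ d)) /=; last first.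
  by move=> C /andP[_ dC]; exact: setD1K.
rewrite (eq_bigl (fun C : {set T} => (C \subset D) && (d \notin C))); last first.
  move=> C; rewrite subUset sub1set dD setU11 andbT /=.
  have [dC|dC] := boolP (d \in C); last by rewrite setU1K // eqxx.
  by rewrite andbF; apply/negP => /andP[_ /eqP h]; move: dC; rewrite -h !inE eqxx.
rewrite -big_split /= big1 // => C /andP[_ dC].
by rewrite cardsU1 dC exprS mulN1r addNr.
Qed.

(** After expanding the products, inclusion-exclusion over the sets [A] containing the image of a
    map leaves the surjective maps, that is, the permutations. This will express decomposable
    symmetric tensors through tensor powers. *)
Lemma ryser n (a : 'I_n -> 'I_n -> F) :
  \sum_(A : {set 'I_n}) (-1) ^+ #|~: A| * \prod_i \sum_(j in A) a i j =
  \sum_(p : 'S_n) \prod_i a i (p i).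
Proof.
transitivity (\sum_(f : {ffun 'I_n -> 'I_n}) (f @: [set: 'I_n] == [set: 'I_n])%:R * \prod_i a i (f i)).
  transitivity (\sum_(A : {set 'I_n}) \sum_(f : {ffun 'I_n -> 'I_n} | f @: [set: 'I_n] \subset A)
      (-1) ^+ #|~: A| * \prod_i a i (f i)).
    apply: eq_bigr => A _; rewrite bigA_distr_big mulr_sumr; apply: eq_bigl => f.
    apply/ffun_onP/subsetP => [h _ /imsetP[i _ ->]|h i]; first exact: h.
    by apply: h; rewrite imset_f.
  rewrite (exchange_big_dep predT) //=; apply: eq_bigr => f _; rewrite -mulr_suml; congr (_ * _).
  rewrite (reindex_inj (@setC_inj _)) /=.
  rewrite (eq_bigl (fun C : {set 'I_n} => C \subset ~: (f @: [set: 'I_n]))); last first.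
    by move=> C; rewrite subsetC.
  under eq_bigr do rewrite setCK.
  by rewrite sum_sign_subsets -setCT (inj_eq (@setC_inj _)).
rewrite (bigID (fun f : {ffun 'I_n -> 'I_n} => injectiveb f)) /= [X in _ + X]big1 ?addr0; last first.
  move=> f fi; case: eqP => [h|_]; last by rewrite mul0r.
  move: fi; suff -> : injectiveb f by [].
  apply/injectiveP => i j; apply: (imset_injP (f := f) (D := [set: 'I_n]) _ i j); rewrite ?inE //.
  by rewrite h.
rewrite (reindex (@pval _)) /=; last first.
  exists (fun f => insubd (1%g : 'S_n) f) => [p _|f fi].
    by apply: val_inj; rewrite val_insubd ifT //; exact: (valP p).
  by rewrite -[LHS]/(val _) val_insubd ifT.
apply: eq_big => [p|p _]; first exact: (valP p).
rewrite (_ : _ == _) ?mul1r; first by apply: eq_bigr => i _; rewrite pvalE.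
rewrite eqEcard subsetT /= card_imset //.
by apply/injectiveP; exact: (valP p).
Qed.

End Ryser.


From mathcomp Require Import complex cyclic separable cyclotomic.
From mathcomp Require Import all_classical all_reals all_analysis.
From mathcomp Require Import ring lra.
Require Import Defs.

Import Order.TTheory GRing.Theory Num.Theory.
Import numFieldNormedType.Exports.

Local Open Scope classical_set_scope.
Local Open Scope ring_scope.
Local Open Scope complex_scope.

Local Notation "A \* B" := (bopM A B) : ring_scope.

(** * Hilbert spaces and bounded operators *)

Section RealNorm.
Context {R : realType}.

(* Norms over [R[i]] are [R[i]]-valued; [nm] is the same norm as a real number. *)
Definition nm {V : normedZmodType R[i]} (x : V) : R := complex.Re `|x|.

Lemma nmE {V : normedZmodType R[i]} (x : V) : `|x| = (nm x)%:C.
Proof.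
have := normr_real x; rewrite /nm; case: `|x| => a b.
by rewrite realE !lecE /= => /orP[] /andP[/eqP h _]; rewrite ?h // -h.
Qed.

Section Zmod.
Context {V : normedZmodType R[i]}.
Implicit Types x y z : V.

Lemma nm_ge0 x : 0 <= nm x.
Proof. by rewrite -lecR -nmE normr_ge0. Qed.

Lemma nm0 : nm (0 : V) = 0.
Proof. by rewrite /nm normr0. Qed.

Lemma nm_eq0 x : (nm x == 0) = (x == 0).
Proof. by rewrite -(inj_eq (@complexI R)) -nmE normr_eq0. Qed.

Lemma nm_gt0 x : (0 < nm x) = (x != 0).
Proof. by rewrite lt_def nm_ge0 nm_eq0 andbT. Qed.

Lemma nm_triangle x y : nm (x + y) <= nm x + nm y.
Proof. by rewrite -lecR rmorphD /= -!nmE ler_normD. Qed.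

Lemma nmN x : nm (- x) = nm x.
Proof. by rewrite /nm normrN. Qed.

Lemma nm_distC x y : nm (x - y) = nm (y - x).
Proof. by rewrite /nm distrC. Qed.

Lemma nm_triangleB x y z : nm (x - z) <= nm (x - y) + nm (y - z).
Proof. by rewrite -[x - z](subrKA y) nm_triangle. Qed.

Lemma nm_le_small x : (forall e, 0 < e -> nm x <= e) -> x = 0.
Proof.
move=> h; apply/eqP; rewrite -nm_eq0 eq_le nm_ge0 andbT.
by apply/ler_addgt0Pr => e e0; rewrite add0r h.
Qed.

Lemma nm_sum (I : Type) (r : seq I) (F : I -> V) :
  nm (\sum_(i <- r) F i) <= \sum_(i <- r) nm (F i).
Proof.
elim: r => [|i r IH]; first by rewrite !big_nil nm0.
by rewrite !big_cons (le_trans (nm_triangle _ _)) // lerD2l.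
Qed.

End Zmod.

Lemma nmM (a b : R[i]) : nm (a * b) = nm a * nm b.
Proof. by apply: (@complexI R); rewrite rmorphM /= -!nmE normrM. Qed.

Lemma nmZ (V : normedModType R[i]) (a : R[i]) (x : V) : nm (a *: x) = nm a * nm x.
Proof. by apply: (@complexI R); rewrite rmorphM /= -!nmE normrZ. Qed.

Lemma nm_real (r : R) : nm (r%:C : R[i]) = `|r|.
Proof. by apply: (@complexI R); rewrite -nmE normc_def /= expr0n addr0 sqrtr_sqr. Qed.

Lemma nm_conj (a : R[i]) : nm (conjc a) = nm a.
Proof. by case: a => a b; rewrite /nm !normc_def /= sqrrN. Qed.

Lemma nm_sqr (a : R[i]) : a * conjc a = (nm a ^+ 2)%:C.
Proof. by rewrite rmorphXn /= -nmE sqr_normc. Qed.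

Lemma nmX (a : R[i]) n : nm (a ^+ n) = nm a ^+ n.
Proof. by apply: (@complexI R); rewrite rmorphXn /= -!nmE normrX. Qed.

Lemma nm1 : nm (1 : R[i]) = 1.
Proof. by rewrite /nm normr1. Qed.

End RealNorm.

Section InnerProduct.
Context {R : realType} {H : hilbertType R}.
Implicit Types (x y z : H) (a b : R[i]).

Lemma dotpDl x y z : dotp (x + y) z = dotp x z + dotp y z.
Proof. by rewrite dotp_conj dotpDr rmorphD /= -!dotp_conj. Qed.

Lemma dotpZl a x y : dotp (a *: x) y = conjc a * dotp x y.
Proof. by rewrite dotp_conj dotpZr rmorphM /= -dotp_conj. Qed.

Lemma dotp0r x : dotp x 0 = 0.
Proof. by rewrite -(scale0r (0 : H)) dotpZr mul0r. Qed.

Lemma dotp0l x : dotp 0 x = 0.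
Proof. by rewrite dotp_conj dotp0r rmorph0. Qed.

Lemma dotpNr x y : dotp x (- y) = - dotp x y.
Proof. by rewrite -scaleN1r dotpZr mulN1r. Qed.

Lemma dotpNl x y : dotp (- x) y = - dotp x y.
Proof. by rewrite dotp_conj dotpNr rmorphN /= -dotp_conj. Qed.

Lemma dotpBr x y z : dotp x (y - z) = dotp x y - dotp x z.
Proof. by rewrite dotpDr dotpNr. Qed.

Lemma dotpBl x y z : dotp (x - y) z = dotp x z - dotp y z.
Proof. by rewrite dotpDl dotpNl. Qed.

Lemma dotp_sumr (I : Type) (r : seq I) (P : pred I) (F : I -> H) x :
  dotp x (\sum_(i <- r | P i) F i) = \sum_(i <- r | P i) dotp x (F i).
Proof. exact: (big_morph (dotp x) (dotpDr x) (dotp0r x)). Qed.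

Lemma dotp_suml (I : Type) (r : seq I) (P : pred I) (F : I -> H) x :
  dotp (\sum_(i <- r | P i) F i) x = \sum_(i <- r | P i) dotp (F i) x.
Proof. exact: (big_morph (fun y => dotp y x) (fun y z => dotpDl y z x) (dotp0l x)). Qed.

Lemma dotp_nm x : dotp x x = (nm x ^+ 2)%:C.
Proof. by rewrite dotp_norm nmE rmorphXn. Qed.

Lemma dotp_eq0 x : dotp x x = 0 -> x = 0.
Proof.
rewrite dotp_nm => /(@complexI R) /eqP.
by rewrite sqrf_eq0 nm_eq0 => /eqP.
Qed.

Lemma dotp_ext x y : (forall z, dotp z x = dotp z y) -> x = y.
Proof.
move=> h; apply/eqP; rewrite -subr_eq0; apply/eqP/dotp_eq0.
by rewrite dotpBr h subrr.
Qed.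

Lemma dotp0C x y : dotp x y = 0 -> dotp y x = 0.
Proof. by move=> h; rewrite dotp_conj h rmorph0. Qed.

Lemma nmD_sqr x y : ((nm (x + y)) ^+ 2)%:C = (nm x ^+ 2)%:C + dotp x y + dotp y x + (nm y ^+ 2)%:C :> R[i].
Proof. by rewrite -!dotp_nm dotpDl !dotpDr; ring. Qed.

Lemma pythagoras x y : dotp x y = 0 -> nm (x + y) ^+ 2 = nm x ^+ 2 + nm y ^+ 2.
Proof.
move=> h; apply: (@complexI R).
by rewrite nmD_sqr h (dotp0C h) !addr0 rmorphD.
Qed.

Lemma nm_sqrC_neq0 x : x != 0 -> (nm x ^+ 2)%:C != 0 :> R[i].
Proof. by move=> x0; rewrite -dotp_nm; apply/eqP => /dotp_eq0 /eqP; apply/negP. Qed.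

Lemma dotp_proj_line x y : x != 0 -> dotp x (y - (dotp x y / (nm x ^+ 2)%:C) *: x) = 0.
Proof.
by move=> x0; rewrite dotpBr dotpZr dotp_nm divfK ?subrr // nm_sqrC_neq0.
Qed.

(** The coefficient minimizes the distance from [y] to the line through [x]; Cauchy-Schwarz and the
    minimizing argument in [orth_projection] both rest on this identity. *)
Lemma nm_proj_line x y : x != 0 ->
  nm (y - (dotp x y / (nm x ^+ 2)%:C) *: x) ^+ 2 = nm y ^+ 2 - nm (dotp x y) ^+ 2 / nm x ^+ 2.
Proof.
move=> x0; have nx0 : nm x != 0 by rewrite nm_eq0.
set t := _ / _; set z := y - _.
have xz : dotp z (t *: x) = 0.
  by rewrite dotpZr; apply/eqP; rewrite mulf_eq0 (dotp0C (dotp_proj_line y x0)) eqxx orbT.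
have := pythagoras xz; rewrite subrK => ->.
rewrite nmZ /t nmM -fmorphV nm_real ger0_norm ?invr_ge0 ?sqr_ge0 //.
by field.
Qed.

Lemma cauchy_schwarz x y : nm (dotp x y) <= nm x * nm y.
Proof.
have [->|x0] := eqVneq x 0; first by rewrite dotp0l !nm0 mul0r.
have nx0 : 0 < nm x by rewrite nm_gt0.
have : nm (dotp x y) ^+ 2 / nm x ^+ 2 <= nm y ^+ 2.
  by rewrite -subr_ge0 -nm_proj_line // sqr_ge0.
rewrite ler_pdivrMr ?exprn_gt0// -exprMn ler_sqr ?nnegrE ?nm_ge0 ?mulr_ge0 ?nm_ge0//.
by rewrite mulrC.
Qed.

Lemma parallelogram x y :
  nm (x + y) ^+ 2 + nm (x - y) ^+ 2 = 2 * (nm x ^+ 2 + nm y ^+ 2).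
Proof.
apply: (@complexI R); rewrite rmorphD /= !nmD_sqr nmN dotpNr dotpNl.
by rewrite mulr_natl rmorphMn /= rmorphD /=; ring.
Qed.

End InnerProduct.

Section Convergence.
Context {R : realType}.

(** Real epsilons keep the estimates in the ordered field [R]; [tends_toP] links this to filter
    convergence. *)
Definition tends_to {V : normedZmodType R[i]} (u : nat -> V) (l : V) : Prop :=
  forall e : R, 0 < e -> exists N, forall n, (N <= n)%N -> nm (u n - l) < e.

Lemma complex_gt0 (e : R[i]) : 0 < e -> exists2 r : R, 0 < r & e = r%:C.
Proof.
case: e => a b; rewrite ltcE /= => /andP[/eqP -> a0].
by exists a.
Qed.

Lemma nm_ltE {V : normedModType R[i]} (x : V) (e : R) : (`|x| < e%:C) = (nm x < e).
Proof. by rewrite nmE ltcR. Qed.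

Lemma tends_toP {V : normedModType R[i]} (u : nat -> V) (l : V) :
  tends_to u l <-> u @ \oo --> l.
Proof.
split=> [h|/cvgrPdist_lt h].
  apply/cvgrPdist_lt => e /complex_gt0[r r0 ->].
  have [N hN] := h r r0; exists N => // n /= Nn.
  by rewrite nm_ltE nm_distC hN.
move=> e e0; have [|N _ hN] := h e%:C; first by rewrite ltcR.
by exists N => n Nn; rewrite nm_distC -nm_ltE hN.
Qed.

Lemma nm_complete (V : completeNormedModType R[i]) (u : nat -> V) :
  (forall e : R, 0 < e -> exists N, forall n m, (N <= n)%N -> (N <= m)%N ->
     nm (u n - u m) < e) -> exists l, tends_to u l.
Proof.
move=> h; suff /cvg_ex[l ul] : cvg (u @ \oo) by exists l; apply/tends_toP.
apply: cauchy_cvg; apply/cauchyP => e /complex_gt0[r r0 ->].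
have [N hN] := h r r0; exists (u N); exists N => // n /= Nn.
by rewrite -ball_normE /ball_ /= nm_ltE hN.
Qed.

Lemma inv_small (e : R) : 0 < e -> exists N, forall n, (N <= n)%N -> n.+1%:R^-1 < e.
Proof.
move=> e0; have [N hN] := ltr_add_invr (y := 0) (x := e) e0.
exists N => n Nn; apply: le_lt_trans hN.
by rewrite add0r lef_pV2 ?posrE ?ltr0n// ler_nat.
Qed.

End Convergence.

(** * Closures of subspaces and orthogonal projection *)

Section Closure.
Context {R : realType} {H : hilbertType R}.
Implicit Types (x y z : H) (S : set H).

(** Membership in the norm closure of [S]; the subspaces below are not assumed closed. *)
Definition approx S x : Prop := forall e : R, 0 < e -> exists2 s, S s & nm (x - s) < e.

Definition linear_subspace S : Prop := S 0 /\ forall (a : R[i]) x y, S x -> S y -> S (a *: x + y).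

Lemma subspaceD S x y : linear_subspace S -> S x -> S y -> S (x + y).
Proof. by move=> [_ h] Sx Sy; rewrite -[x]scale1r; apply: h. Qed.

Lemma subspaceZ S (a : R[i]) x : linear_subspace S -> S x -> S (a *: x).
Proof. by move=> [h0 h] Sx; rewrite -[_ *: x]addr0; apply: h. Qed.

Lemma subspace_sum S (I : Type) (r : seq I) (F : I -> H) :
  linear_subspace S -> (forall i, S (F i)) -> S (\sum_(i <- r) F i).
Proof.
move=> hS h; elim: r => [|i r IH]; first by rewrite big_nil; apply: hS.1.
by rewrite big_cons; apply: subspaceD.
Qed.

Lemma approx_dotp0 S x y : approx S x -> (forall s, S s -> dotp s y = 0) -> dotp x y = 0.
Proof.
move=> Sx h; apply: nm_le_small => e e0.
have [s Ss xs] := Sx (e / (nm y + 1)) (divr_gt0 e0 (ltr_wpDl (nm_ge0 _) ltr01)).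
rewrite -[x](subrK s) dotpDl (h s) // addr0.
apply: le_trans (cauchy_schwarz _ _) _.
have := nm_ge0 y; have := nm_ge0 (x - s); move: xs.
rewrite ltr_pdivlMr; last by rewrite ltr_wpDl ?nm_ge0.
by nra.
Qed.

Lemma lspan_subspace S : linear_subspace (lspan S).
Proof.
split; first by exists 0%N, (fun _ => 0), (fun _ => 0); split; [case|rewrite big_ord0].
move=> a x y [n [c [v [hv ->]]]] [m [c' [v' [hv' ->]]]].
exists (n + m)%N, (fun i => match fintype.split i with inl j => a * c j | inr j => c' j end),
  (fun i => match fintype.split i with inl j => v j | inr j => v' j end); split.
  by move=> i; case: fintype.split => j.
rewrite big_split_ord /= scaler_sumr; congr (_ + _); apply: eq_bigr => i _.
  by rewrite (unsplitK (inl i : 'I_n + 'I_m)%type) scalerA.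
by rewrite (unsplitK (inr i : 'I_n + 'I_m)%type).
Qed.

Lemma lspan_sub S x : S x -> lspan S x.
Proof.
move=> Sx; exists 1%N, (fun _ => 1), (fun _ => x); split => //.
by rewrite big_ord1 scale1r.
Qed.

Lemma lspan_min S T : linear_subspace T -> (forall x, S x -> T x) -> forall x, lspan S x -> T x.
Proof.
move=> hT ST x [n [c [v [hv ->]]]].
by apply: subspace_sum => // i; apply: subspaceZ => //; apply: ST.
Qed.

Lemma dense_approx S : dense S -> forall x, approx S x.
Proof.
move=> dS x e e0.
have e0' : (0 : R[i]) < e%:C by rewrite ltcR.
have [y [xy Sy]] : (ball x e%:C)^° `&` S !=set0.
  apply: dS; last exact: open_interior.
  by exists x; exact: nbhsx_ballx.
exists y => //; move: (interior_subset xy).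
by rewrite -ball_normE /ball_ /= nm_ltE.
Qed.

Lemma total_orth S y : (forall x, approx (lspan S) x) ->
  (forall s, S s -> dotp s y = 0) -> y = 0.
Proof.
move=> dS h; apply: dotp_eq0; apply: (approx_dotp0 (dS y)).
move=> s; apply: (lspan_min (T := [set s | dotp s y = 0])) => //.
split=> [|a u v /= hu hv]; first exact: dotp0l.
by rewrite dotpDl dotpZl hu hv mulr0 addr0.
Qed.

Lemma tends_to_dotp x (u : nat -> H) l : tends_to u l ->
  forall e : R, 0 < e -> exists N, forall n, (N <= n)%N -> nm (dotp x (u n) - dotp x l) < e.
Proof.
move=> h e e0.
have x0 : 0 < nm x + 1 by rewrite ltr_wpDl ?nm_ge0.
have [N hN] := h (e / (nm x + 1)) (divr_gt0 e0 x0).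
exists N => n Nn; rewrite -dotpBr; apply: le_lt_trans (cauchy_schwarz _ _) _.
have := hN n Nn; rewrite ltr_pdivlMr //.
have := nm_ge0 x; have := nm_ge0 (u n - l); nra.
Qed.

(** A minimizing sequence [u] for the distance from [x] to [S] is Cauchy by the parallelogram law,
    and [x - u n] is asymptotically orthogonal to [S]. The limit lies in the closure of [S]. *)
Lemma orth_projection S x : linear_subspace S ->
  exists2 y, approx S y & forall s, S s -> dotp s (x - y) = 0.
Proof.
move=> hS; pose D := [set r : R | exists2 s, S s & r = nm (x - s) ^+ 2].
have hD : has_inf D.
  split; first by exists (nm (x - 0) ^+ 2), 0 => //; apply: hS.1.
  by exists 0 => _ [s _ ->]; rewrite sqr_ge0.
pose d := inf D.
have dle s : S s -> d <= nm (x - s) ^+ 2.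
  by move=> Ss; apply: ge_inf; [exact: hD.2|exists s].
have /choice[u hu] n : exists s, S s /\ nm (x - s) ^+ 2 < d + n.+1%:R^-1.
  have i0 : 0 < n.+1%:R^-1 :> R by rewrite invr_gt0.
  have [_ [s Ss ->] hs] := inf_adherent i0 hD.
  by exists s.
(* Moving [u n] by the optimal multiple of [s] lowers the squared distance by
   [nm c ^+ 2 / nm s ^+ 2], while at most [n.+1%:R^-1] is left to gain. *)
have orth n s : S s -> nm (dotp s (x - u n)) ^+ 2 <= nm s ^+ 2 * n.+1%:R^-1.
  move=> Ss; have [->|s0] := eqVneq s 0; first by rewrite dotp0l !nm0 !expr0n mul0r.
  have ns0 : 0 < nm s ^+ 2 by rewrite exprn_gt0 // nm_gt0.
  set c := dotp s (x - u n); pose t := c / (nm s ^+ 2)%:C.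
  have := dle (t *: s + u n) (hS.2 _ _ _ Ss (hu n).1).
  have -> : x - (t *: s + u n) = (x - u n) - t *: s by rewrite opprD addrA addrAC.
  rewrite nm_proj_line // -/c => h1; have := (hu n).2 => h2.
  rewrite mulrC -ler_pdivrMr //.
  have aux (p q r d' : R) : d' <= r - p -> r < d' + q -> p <= q by lra.
  exact: aux h1 h2.
have uc : forall e : R, 0 < e -> exists N, forall n m, (N <= n)%N -> (N <= m)%N ->
     nm (u n - u m) < e.
  (* The midpoint of [u n] and [u m] lies in [S], so the squared distance of [u n] and [u m] is at
     most twice the sum of their excesses over the infimum. *)
  move=> e e0; have [N hN] := inv_small (e := e ^+ 2 / 4) (ltac:(by rewrite divr_gt0 ?exprn_gt0)).
  exists N => n m Nn Nm.
  rewrite -ltr_sqr ?nnegrE ?nm_ge0 ?ltW//.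
  have := parallelogram (x - u n) (x - u m).
  have -> : x - u n - (x - u m) = - (u n - u m) by rewrite !opprB addrC subrKA.
  have -> : x - u n + (x - u m) = 2%:R *: (x - (2^-1 *: u n + 2^-1 *: u m)).
    rewrite scalerBr scalerDr !scalerA mulfV ?pnatr_eq0 // !scale1r scaler_nat mulr2n.
    by rewrite opprD addrACA.
  rewrite nmN nmZ exprMn => hp.
  have := dle (2^-1 *: u n + 2^-1 *: u m).
  have Sm : S (2^-1 *: u n + 2^-1 *: u m).
    by apply: hS.2; [exact: (hu n).1|apply: subspaceZ => //; exact: (hu m).1].
  move=> /(_ Sm) dz.
  have n2 : nm (2%:R : R[i]) = 2 by rewrite -(rmorph_nat (@real_complex_def R _)) nm_real normr_nat.
  rewrite n2 in hp.
  have aux (A B d' p q z w f : R) : 2 ^+ 2 * z + w = 2 * (A + B) -> p < f / 4 -> q < f / 4 ->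
    A < d' + p -> B < d' + q -> d' <= z -> w < f by lra.
  exact: aux hp (hN n Nn) (hN m Nm) (hu n).2 (hu m).2 dz.
have [y uy] := nm_complete uc.
exists y.
  move=> e e0; have [N hN] := uy e e0; exists (u N); first exact: (hu N).1.
  by rewrite nm_distC hN.
move=> s Ss; apply: nm_le_small => e e0.
have [N hN] := tends_to_dotp s uy (e := e / 2) (ltac:(by rewrite divr_gt0)).
have s0 : 0 < nm s ^+ 2 + 1 by rewrite ltr_wpDl ?sqr_ge0.
have s1 : 0 < (e / 2) ^+ 2 / (nm s ^+ 2 + 1) by rewrite divr_gt0 ?exprn_gt0 ?divr_gt0.
have [M hM] := inv_small s1.
pose n := maxn N M.
have h1 := hN n (leq_maxl _ _); have h2 := orth n s Ss.
have h3 : nm (dotp s (x - u n)) <= e / 2.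
  rewrite -ler_sqr ?nnegrE ?nm_ge0 ?divr_ge0 ?ltW//; apply: le_lt_trans h2 _.
  have := hM n (leq_maxr _ _); rewrite ltr_pdivlMr // => h.
  have i0 : (0:R) < n.+1%:R^-1 by rewrite invr_gt0.
  have aux (p q f : R) : p * (q + 1) < f -> 0 < p -> q * p < f by nra.
  exact: aux h i0.
have -> : x - y = (x - u n) + (u n - y) by rewrite subrKA.
rewrite dotpDr (le_trans (nm_triangle _ _)) //.
rewrite -dotpBr in h1; move: h1 h3; lra.
Qed.

End Closure.

(** * Adjoints, isometries and extension by continuity *)

Section Operators.
Context {R : realType}.
Implicit Types H : hilbertType R.

Lemma bop_bounded H H' (A : bop H H') : exists2 M : R, 0 <= M & forall x, nm (A x) <= M * nm x.
Proof.
have /linear_bounded_continuous /linear_boundedP [M [Mr hM]] := @bop_continuous _ _ _ A.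
have := hM (M + 1); rewrite ltrDl ltr01 => /(_ isT) h.
exists (nm (M + 1)); first exact: nm_ge0.
move=> x; rewrite -lecR rmorphM /= -!nmE (le_trans (h x)) //.
by rewrite ler_wpM2r // real_ler_norm // realD.
Qed.

Section MkBop.
Variables (H H' : hilbertType R) (f : H -> H') (M : R).
Hypothesis fl : linear f.
Hypothesis fM : forall x, nm (f x) <= M * nm x.

Let f' : H -> H' := f.
HB.instance Definition _ := GRing.isLinear.Build R[i] H H' *:%R f' fl.

Lemma bounded_continuous : continuous f.
Proof.
have /linear_bounded_continuous // : bounded_near f' (nbhs (0 : H)).
apply/linear_boundedP; exists M%:C; split; first by rewrite complex_real.
move=> r Mr x; rewrite /f'; apply: (le_trans (y := M%:C * `|x|)).
  by rewrite !nmE -rmorphM lecR fM.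
by rewrite ler_wpM2r // ltW.
Qed.

Definition mk_bop : bop H H' := Bop fl bounded_continuous.
End MkBop.

Lemma riesz H (f : H -> R[i]) (M : R) :
  (forall a x y, f (a *: x + y) = a * f x + f y) ->
  (forall x, nm (f x) <= M * nm x) ->
  exists y, forall x, f x = dotp y x.
Proof.
move=> fl fM.
have f0 : f 0 = 0.
  by apply/eqP; rewrite -nm_eq0 eq_le nm_ge0 andbT (le_trans (fM 0)) // nm0 mulr0.
have fZ a x : f (a *: x) = a * f x by rewrite -[_ *: _]addr0 fl f0 addr0.
have fB x y : f (x - y) = f x - f y by rewrite addrC -scaleN1r fl mulN1r addrC.
have [h0|/existsNP[x0 fx0]] := pselect (forall x, f x = 0).
  by exists 0 => x; rewrite h0 dotp0l.
pose S := [set x | f x = 0].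
have hS : linear_subspace S.
  by split=> [|a x y hx hy]; [exact: f0|rewrite /S /= fl hx hy mulr0 addr0].
have [y0 ay0 oy0] := orth_projection x0 hS.
have fy0 : f y0 = 0.
  apply: nm_le_small => e e0.
  have M0 : 0 < `|M| + 1 by rewrite ltr_wpDl.
  have [s fs hs] := ay0 (e / (`|M| + 1)) (divr_gt0 e0 M0).
  have -> : f y0 = f (y0 - s) by rewrite fB fs subr0.
  apply: le_trans (fM _) _; move: hs; rewrite ltr_pdivlMr //.
  have := ler_norm M; have := nm_ge0 (y0 - s); nra.
set z := x0 - y0 in oy0.
have fz : f z != 0 by rewrite fB fy0 subr0; apply/eqP.
have z0 : z != 0 by apply: contra_neq fz => ->.
have zz0 : dotp z z != 0 by rewrite dotp_nm nm_sqrC_neq0.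
(* [z] spans the orthogonal complement of the kernel; the conjugate compensates for the
   antilinearity of [dotp] on the left. *)
exists (conjc (f z / dotp z z) *: z) => x.
rewrite dotpZl conjcK.
have := oy0 (x - (f x / f z) *: z); rewrite /S /= fB fZ divfK // subrr => /(_ erefl).
move/dotp0C; rewrite dotpBr dotpZr => /eqP; rewrite subr_eq0 => /eqP ->.
by field; rewrite fz zz0.
Qed.

Lemma adj_exists H H' (A : bop H H') :
  exists B : bop H' H, forall x y, dotp (A x) y = dotp x (B y).
Proof.
have [M M0 hM] := bop_bounded A.
have /choice[B hB] y : exists w, forall x, dotp y (A x) = dotp w x.
  apply: (riesz (M := nm y * M)) => [a u v|x]; first by rewrite linearP dotpDr dotpZr.
  by rewrite (le_trans (cauchy_schwarz _ _)) // -mulrA ler_wpM2l ?nm_ge0.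
have hB' x y : dotp (A x) y = dotp x (B y) by rewrite dotp_conj hB -dotp_conj.
have Bl : linear B.
  move=> a u v; apply: dotp_ext => z.
  by rewrite -hB' !dotpDr !dotpZr !hB'.
have BM y : nm (B y) <= M * nm y.
  have [->|By0] := eqVneq (B y) 0; first by rewrite nm0 mulr_ge0 ?nm_ge0.
  have By : 0 < nm (B y) by rewrite nm_gt0.
  have h : nm (B y) ^+ 2 <= nm y * (M * nm (B y)).
    rewrite -[X in X <= _]ger0_norm ?sqr_ge0 // -nm_real -dotp_nm -hB.
    by rewrite (le_trans (cauchy_schwarz _ _)) // ler_wpM2l ?nm_ge0.
  by rewrite -(ler_pM2r By) -expr2 (le_trans h) // mulrA [nm y * M]mulrC lexx.
by exists (mk_bop Bl BM) => x y; rewrite hB'.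
Qed.

Lemma adjE H H' (A : bop H H') x y : dotp (A x) y = dotp x (adj A y).
Proof.
rewrite /adj; case: xgetP => [B _ hB|h]; first exact: hB.
by have [B hB] := adj_exists A; have := h B hB.
Qed.

Lemma adjE' H H' (A : bop H H') x y : dotp (adj A x) y = dotp x (A y).
Proof. by rewrite dotp_conj -adjE -dotp_conj. Qed.

Lemma adj_eq H H' (A : bop H H') (B : bop H' H) :
  (forall x y, dotp (A x) y = dotp x (B y)) -> adj A = B.
Proof. by move=> h; apply: bopP => y; apply: dotp_ext => z; rewrite -adjE h. Qed.

Lemma adjK H H' (A : bop H H') : adj (adj A) = A.
Proof. by apply: adj_eq => x y; rewrite adjE'. Qed.

Lemma adjM H1 H2 H3 (A : bop H2 H3) (B : bop H1 H2) : adj (A \* B) = adj B \* adj A.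
Proof. by apply: adj_eq => x y /=; rewrite !adjE. Qed.

Lemma bopMA H1 H2 H3 H4 (A : bop H3 H4) (B : bop H2 H3) (C : bop H1 H2) :
  A \* (B \* C) = A \* B \* C.
Proof. exact: bopP. Qed.

Lemma bop1M H H' (A : bop H H') : bop1 \* A = A.
Proof. exact: bopP. Qed.

Lemma bopM1 H H' (A : bop H H') : A \* bop1 = A.
Proof. exact: bopP. Qed.

(** Polarization: norms determine [dotp x y + dotp y x], and with ['i *: y] in place of [y] they
    determine the difference. *)
Lemma isometry_dotp H H' (A : bop H H') :
  isometry A -> forall x y, dotp (A x) (A y) = dotp x y.
Proof.
move=> hA; have nA x : nm (A x) = nm x by rewrite /nm hA.
have re x y : dotp (A x) (A y) + dotp (A y) (A x) = dotp x y + dotp y x.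
  have := nmD_sqr x y; rewrite -(nA (x + y)) linearD nmD_sqr !nA.
  move/addIr; rewrite -!addrA; exact: addrI.
move=> x y; have h1 := re x y; have := re x ('i *: y).
rewrite linearZ /= !dotpZr !dotpZl.
have -> : conjc ('i : R[i]) = - 'i by exact: conjCi.
rewrite !mulNr -!mulrBr => /(mulfI (neq0Ci _)) h2.
apply: (mulfI (x := 2%:R)); first by rewrite pnatr_eq0.
rewrite !mulr_natl !mulr2n.
have e (p q : R[i]) : p + p = (p + q) + (p - q) by ring.
by rewrite (e _ (dotp (A y) (A x))) h1 h2; ring.
Qed.

Lemma isometry_adj H H' (A : bop H H') : isometry A -> adj A \* A = bop1.
Proof.
move=> hA; apply: bopP => x; apply: dotp_ext => y /=.
by rewrite -adjE isometry_dotp.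
Qed.

(** Passing to adjoints turns the agreement on [S] into orthogonality to a total set. *)
Lemma bop_total_eq H H' (A B : bop H H') (S : set H) :
  (forall x, approx (lspan S) x) -> (forall x, S x -> A x = B x) -> A = B.
Proof.
move=> dS h; apply: bopP => x; apply: dotp_ext => y; rewrite -[A]adjK -[B]adjK -!adjE.
congr (dotp _ x); apply/eqP; rewrite -subr_eq0; apply/eqP/(total_orth dS) => s /h ABs.
by rewrite dotpBr -!adjE ABs subrr.
Qed.

Section Extension.
Variables (H H' : hilbertType R) (G : H -> H' -> Prop) (M : R).
Hypothesis M0 : 0 <= M.
Hypothesis GD : forall a x y x' y', G x y -> G x' y' -> G (a *: x + x') (a *: y + y').
Hypothesis GM : forall x y, G x y -> nm y <= M * nm x.
Hypothesis Gdense : forall x, approx [set u | exists v, G u v] x.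

(** The closure of the graph [G]; the bound by [M] makes it single-valued. *)
Let Gc x y := forall e : R, 0 < e -> exists u v, [/\ G u v, nm (x - u) < e & nm (y - v) < e].

Let Gc_total x : exists y, Gc x y.
Proof.
have /choice[u /choice[v huv]] n : exists u v, G u v /\ nm (x - u) < n.+1%:R^-1.
  have i0 : 0 < n.+1%:R^-1 :> R by rewrite invr_gt0.
  by have [u [v Guv] hu] := Gdense x i0; exists u, v.
have M1 : 0 < M + 1 by rewrite ltr_wpDl.
have cv : forall e : R, 0 < e -> exists N, forall n m, (N <= n)%N -> (N <= m)%N -> nm (v n - v m) < e.
  move=> e e0; have [N hN] := inv_small (divr_gt0 (divr_gt0 e0 M1) (ltr0n R 2)).
  exists N => n m Nn Nm.
  have /GM h : G (u n - u m) (v n - v m).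
    by have := GD (-1) (huv m).1 (huv n).1; rewrite !scaleN1r ![- _ + _]addrC.
  apply: le_lt_trans h _.
  have h1 : nm (u n - u m) < e / (M + 1).
    have := nm_triangleB (u n) x (u m); rewrite (nm_distC (u n) x).
    have := lt_trans (huv n).2 (hN n Nn); have := lt_trans (huv m).2 (hN m Nm).
    set a := e / (M + 1).
    lra.
  move: h1; rewrite ltr_pdivlMr //; have := nm_ge0 (u n - u m); move: M0; nra.
have [y vy] := nm_complete cv.
exists y => e e0; have [N hN] := vy e e0; have [N' hN'] := inv_small e0.
exists (u (maxn N N')), (v (maxn N N')); split; first exact: (huv _).1.
  exact: lt_trans (huv _).2 (hN' _ (leq_maxr _ _)).
by rewrite nm_distC hN // leq_maxl.
Qed.

Let Gc_lin a x y x' y' : Gc x y -> Gc x' y' -> Gc (a *: x + x') (a *: y + y').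
Proof.
move=> h h' e e0.
have a1 : 0 < nm a + 1 by rewrite ltr_wpDl ?nm_ge0.
have e1 : 0 < e / 2 / (nm a + 1) by rewrite !divr_gt0.
have e2 : 0 < e / 2 by rewrite divr_gt0.
have [u [v [g1 xu yv]]] := h _ e1; have [u' [v' [g1' xu' yv']]] := h' _ e2.
have aux (V : normedModType R[i]) (s t s' t' : V) : nm (s - t) < e / 2 / (nm a + 1) ->
    nm (s' - t') < e / 2 -> nm (a *: s + s' - (a *: t + t')) < e.
  move=> h1 h2; rewrite opprD addrACA -scalerBr.
  apply: le_lt_trans (nm_triangle _ _) _; rewrite nmZ.
  move: h1; rewrite ltr_pdivlMr //; have := nm_ge0 a; have := nm_ge0 (s - t); nra.
by exists (a *: u + u'), (a *: v + v'); split; [exact: GD|exact: aux|exact: aux].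
Qed.

Let Gc_bound x y : Gc x y -> nm y <= M * nm x.
Proof.
move=> h; apply/ler_addgt0Pr => e e0.
have M1 : 0 < M + 1 by rewrite ltr_wpDl.
have [u [v [/GM g xu yv]]] := h _ (divr_gt0 e0 M1).
have h1 := nm_triangle (y - v) v; rewrite subrK in h1.
have h2 := nm_triangle (u - x) x; rewrite subrK nm_distC in h2.
move: xu yv; rewrite !ltr_pdivlMr //.
have := nm_ge0 (x - u); have := nm_ge0 (y - v); have := nm_ge0 x; move: M0 h1 h2 g; nra.
Qed.

Lemma bounded_graph_extend : exists T : bop H H', forall x y, G x y -> T x = y.
Proof.
have fn x y y' : Gc x y -> Gc x y' -> y = y'.
  move=> h h'; apply/eqP; rewrite -subr_eq0 -nm_eq0 eq_le nm_ge0 andbT.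
  have := Gc_lin (-1) h' h; rewrite !scaleN1r addNr => /Gc_bound.
  by rewrite nm0 mulr0 addrC.
have [T hT] := choice Gc_total.
have Tl : linear T by move=> a x y; apply: (fn _ _ _ (hT _)); apply: Gc_lin.
have TM x : nm (T x) <= M * nm x by apply: Gc_bound.
exists (mk_bop Tl TM) => x y Gxy /=; apply: (fn _ _ _ (hT x)) => e e0.
by exists x, y; rewrite !subrr !nm0.
Qed.

End Extension.

(** The inequality also makes the assignment well defined: a vanishing combination of the [e i]
    forces that of the [f i] to vanish. Creation operators, second quantizations and Weyl operators
    all arise in this way. *)
Lemma total_extend H H' (I : Type) (e : I -> H) (f : I -> H') (M : R) : 0 <= M ->
  (forall x, approx (lspan (range e)) x) ->
  (forall c : seq (R[i] * I),
    nm (\sum_(p <- c) p.1 *: f p.2) <= M * nm (\sum_(p <- c) p.1 *: e p.2)) ->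
  exists T : bop H H', forall i, T (e i) = f i.
Proof.
move=> M0 de hM.
pose G x y := exists c : seq (R[i] * I),
  x = \sum_(p <- c) p.1 *: e p.2 /\ y = \sum_(p <- c) p.1 *: f p.2.
have G0 : G 0 0 by exists [::]; rewrite !big_nil.
have GD a x y x' y' : G x y -> G x' y' -> G (a *: x + x') (a *: y + y').
  move=> [c [-> ->]] [c' [-> ->]].
  exists ([seq (a * p.1, p.2) | p <- c] ++ c'); rewrite !big_cat /= !big_map !scaler_sumr.
  by split; congr (_ + _); apply: eq_bigr => p _; rewrite scalerA.
have GM x y : G x y -> nm y <= M * nm x by move=> [c [-> ->]]; exact: hM.
have Gd x : approx [set u | exists v, G u v] x.
  move=> d d0; have [s hs xs] := de x d d0; exists s => //.
  apply: lspan_min hs; last first.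
    by move=> _ [i _ <-]; exists (f i), [:: (1, i)]; rewrite !big_seq1 !scale1r.
  split; first by exists 0.
  by move=> a u u' [v h] [v' h']; exists (a *: v + v'); apply: GD.
have [T hT] := bounded_graph_extend M0 GD GM Gd.
exists T => i; apply: hT; exists [:: (1, i)].
by rewrite !big_seq1 !scale1r.
Qed.

End Operators.

(** * Commutants of the range of a normal endomorphism *)

Section RankOne.
Context {R : realType}.
Implicit Types H : hilbertType R.

Lemma bopDE H H' (A B : bop H H') x : (A + B) x = A x + B x. Proof. by []. Qed.
Lemma bopZE H H' (a : R[i]) (A : bop H H') x : (a *: A) x = a *: A x. Proof. by []. Qed.
Lemma bop0E H H' x : (0 : bop H H') x = 0. Proof. by []. Qed.

Lemma bopDr H H' (A : bop H H') x y : A (x + y) = A x + A y.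
Proof. exact: linearD. Qed.

Lemma bopBr H H' (A : bop H H') x y : A (x - y) = A x - A y.
Proof. exact: linearB. Qed.

Lemma bopZr H H' (A : bop H H') a x : A (a *: x) = a *: A x.
Proof. exact: linearZ. Qed.

Lemma bopNr H H' (A : bop H H') x : A (- x) = - A x.
Proof. exact: linearN. Qed.

Lemma bopNE H H' (A : bop H H') x : (- A) x = - A x.
Proof. by rewrite -scaleN1r bopZE scaleN1r. Qed.

Lemma bopBE H H' (A B : bop H H') x : (A - B) x = A x - B x.
Proof. by rewrite -scaleN1r bopDE bopZE scaleN1r. Qed.

Lemma bop_sumE H H' (I : Type) (r : seq I) (F : I -> bop H H') x :
  (\sum_(i <- r) F i) x = \sum_(i <- r) F i x.
Proof.
elim: r => [|i r IH]; first by rewrite !big_nil.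
by rewrite !big_cons bopDE IH.
Qed.

Section Def.
Variables (H H' : hilbertType R) (x : H') (y : H).

Lemma rank1_linear : linear (fun z => dotp y z *: x).
Proof. by move=> a u v; rewrite dotpDr dotpZr scalerDl scalerA. Qed.

Lemma rank1_bound z : nm (dotp y z *: x) <= nm x * nm y * nm z.
Proof. by rewrite nmZ mulrC -mulrA ler_wpM2l ?nm_ge0 ?cauchy_schwarz. Qed.

(** In Dirac notation, |x><y|. *)
Definition rank1 : bop H H' := mk_bop rank1_linear rank1_bound.
End Def.

Lemma rank1E H H' (x : H') (y z : H) : rank1 x y z = dotp y z *: x.
Proof. by []. Qed.

Lemma adj_rank1 H H' (x : H') (y : H) : adj (rank1 x y) = rank1 y x.
Proof.
by apply: adj_eq => u v /=; rewrite dotpZl dotpZr -dotp_conj mulrC.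
Qed.

Lemma bopM_rank1 H1 H2 H3 (A : bop H2 H3) (x : H2) (y : H1) :
  A \* rank1 x y = rank1 (A x) y.
Proof. by apply: bopP => z /=; rewrite linearZ. Qed.

Lemma rank1M H1 H2 H3 (x : H3) (y z : H2) (w : H1) :
  rank1 x y \* rank1 z w = dotp y z *: rank1 x w.
Proof. by apply: bopP => u; rewrite bopZE /= dotpZr scalerA mulrC. Qed.

Lemma rank1_linearl H H' (y : H) : linear (fun x : H' => rank1 x y).
Proof.
move=> a x x'; apply: bopP => z.
by rewrite bopDE bopZE !rank1E scalerDr !scalerA mulrC.
Qed.

End RankOne.

(** * Finite-rank projections increase to the identity *)

Section Projections.
Context {R : realType} {H : hilbertType R}.
Implicit Types P Q A : 'B(H).

Definition is_proj P : Prop := adj P = P /\ P \* P = P.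

Lemma projM P x : is_proj P -> P (P x) = P x.
Proof. by move=> hP; rewrite -[in RHS]hP.2. Qed.

Lemma proj_dotp P x : is_proj P -> dotp x (P x) = (nm (P x) ^+ 2)%:C.
Proof. by move=> hP; rewrite -dotp_nm adjE hP.1 projM. Qed.

Lemma proj_le P x : is_proj P -> nm (P x) <= nm x.
Proof.
move=> hP; have [->|Px0] := eqVneq (P x) 0; first by rewrite nm0 nm_ge0.
have Px : 0 < nm (P x) by rewrite nm_gt0.
rewrite -(ler_pM2r Px) -expr2.
rewrite -[X in X <= _]ger0_norm ?sqr_ge0 // -nm_real -proj_dotp //.
exact: cauchy_schwarz.
Qed.

Lemma proj_bop_le P Q : is_proj P -> is_proj Q -> Q \* P = P -> bop_le P Q.
Proof.
move=> hP hQ QP x; rewrite !proj_dotp // lecR ler_sqr ?nnegrE ?nm_ge0//.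
have -> : P x = P (Q x).
  by have := congr1 adj QP; rewrite adjM hP.1 hQ.1 => PQ; rewrite -[in LHS]PQ.
exact: proj_le.
Qed.

Lemma proj_ge0 P : is_proj P -> bop_le 0 P.
Proof. by move=> hP x; rewrite bop0E dotp0r proj_dotp // lecR sqr_ge0. Qed.

(** The explicit sum lets a linear endomorphism be evaluated on [P] through rank-one operators. *)
Definition fin_proj P : Prop :=
  is_proj P /\ exists s : seq (H * H), P = \sum_(p <- s) rank1 p.1 p.2.

Lemma fin_proj0 : fin_proj 0.
Proof.
split; last by exists [::]; rewrite big_nil.
by split; [apply: adj_eq => x y; rewrite !bop0E dotp0l dotp0r|apply: bopP].
Qed.

(** A Gram-Schmidt step: the component of [x] orthogonal to the range of [P] is added. *)
Lemma fin_proj_extend1 P x : fin_proj P -> exists Q, [/\ fin_proj Q, Q \* P = P & Q x = x].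
Proof.
move=> [hP [s hs]]; pose y := x - P x.
have Py : P y = 0 by rewrite /y linearB /= projM // subrr.
have [y0|y0] := eqVneq y 0.
  exists P; split; [by split=> //; exists s|exact: hP.2|].
  by apply/esym/eqP; rewrite -subr_eq0 -/y y0.
pose c := (nm y ^- 2)%:C : R[i]; pose Q := P + rank1 (c *: y) y.
have cyy : c * dotp y y = 1.
  by rewrite dotp_nm -rmorphM /= mulVf // expf_neq0 // nm_eq0.
have cc d : conjc (d * c) = conjc d * c by rewrite rmorphM [X in _ * X]conjc_real.
have QE z : Q z = P z + (dotp y z * c) *: y by rewrite bopDE rank1E scalerA.
have yP z : dotp y (P z) = 0 by rewrite -adjE' hP.1 Py dotp0l.
have QP z : Q (P z) = P z by rewrite QE yP mul0r scale0r addr0 projM.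
have Qy : Q y = y by rewrite QE Py add0r mulrC cyy scale1r.
have QL a u v : Q (u + a *: v) = Q u + a *: Q v by rewrite addrC bop_linear addrC.
exists Q; split; last first.
- rewrite QE -[in dotp y x](subrK (P x) x) dotpDr yP addr0 -/y mulrC cyy scale1r.
  by rewrite addrC subrK.
- exact: bopP.
split; last by exists ((c *: y, y) :: s); rewrite big_cons -hs addrC.
split.
  apply: adj_eq => u v; rewrite !QE dotpDl dotpDr dotpZl dotpZr adjE hP.1 cc.
  by rewrite -dotp_conj; ring.
by apply: bopP => z; rewrite -[LHS]/(Q (Q z)) {1}(QE z) QL QP Qy -QE.
Qed.

Lemma fin_proj_extend P (s : seq H) : fin_proj P ->
  exists Q, [/\ fin_proj Q, Q \* P = P & forall x, x \in s -> Q x = x].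
Proof.
move=> hP; elim: s => [|x s [Q [hQ QP Qs]]]; first by exists P; split=> //; exact: hP.1.2.
have [Q' [hQ' QQ Qx]] := fin_proj_extend1 x hQ; exists Q'; split=> //.
  by rewrite -QP bopMA QQ.
move=> y; rewrite in_cons => /orP[/eqP -> //|/Qs Qy].
by rewrite -Qy; exact: (congr1 (fun A : 'B(H) => A y) QQ).
Qed.

Lemma fin_proj_directed : directed fin_proj.
Proof.
split; first by exists 0; exact: fin_proj0.
move=> P Q hP hQ; have [s hs] := hQ.2.
(* The range of [Q] lies in the span of [unzip1 s], so [T] dominates [Q] once it fixes these
   vectors. *)
have [T [hT TP Ts]] := fin_proj_extend (unzip1 s) hP.
exists T => //; split; apply: proj_bop_le => //; [exact: hP.1|exact: hT.1|exact: hQ.1|exact: hT.1|].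
apply: bopP => z /=; rewrite hs bop_sumE linear_sum /=.
rewrite !big_seq; apply: eq_bigr => p ps.
by rewrite linearZ /= Ts // map_f.
Qed.

Lemma proj1 : is_proj bop1.
Proof. by split; [apply: adj_eq|apply: bopP]. Qed.

Lemma fin_proj_lub : is_bop_lub fin_proj bop1.
Proof.
split=> [P hP|T hT x].
  by apply: proj_bop_le; [exact: hP.1|exact: proj1|exact: bop1M].
have [Q [hQ _ Qx]] := fin_proj_extend1 x fin_proj0.
by have := hT Q hQ x; rewrite Qx.
Qed.

End Projections.

Section Density.
Context {R : realType} {H : hilbertType R}.
Variable phi : 'B(H) -> 'B(H).
Hypothesis hphi : normal_unital_star_endo phi.

Lemma endo_sum (I : Type) (r : seq I) (F : I -> 'B(H)) :
  phi (\sum_(i <- r) F i) = \sum_(i <- r) phi (F i).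
Proof.
have phi0 : phi 0 = 0.
  have := endo_linear hphi (-1) 0 0; rewrite !scaleN1r oppr0 addr0 => {1}->.
  by rewrite addNr.
elim: r => [|i r IH]; first by rewrite !big_nil.
rewrite !big_cons -IH -[F i]scale1r (endo_linear hphi) ?scale1r //.
Qed.

Lemma endo_proj P : is_proj P -> is_proj (phi P).
Proof. by case=> aP PP; split; rewrite -?(endo_adj hphi) -?(endo_mul hphi) ?aP ?PP. Qed.

(* If [z <> 0], the projection onto the complement of [z] dominates [phi P] for
   all finite-rank projections [P], hence by normality also [phi 1 = 1]. *)
Lemma endo_rank1_total z :
  (forall x y w, dotp z (phi (rank1 x y) w) = 0) -> z = 0.
Proof.
move=> hz; apply/eqP; apply: contraT => z0.
pose T := bop1 - rank1 ((nm z ^- 2)%:C *: z) z.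
have TE x : T x = x - (dotp z x / (nm z ^+ 2)%:C) *: z.
  by rewrite bopBE rank1E scalerA fmorphV.
have Tdotp x : dotp x (T x) = (nm (T x) ^+ 2)%:C.
  rewrite -dotp_nm {2}TE dotpBl dotpZl TE dotp_proj_line // mulr0 subr0.
  by rewrite -TE.
have lubT : is_bop_lub (phi @` fin_proj) (phi bop1).
  apply: (endo_normal hphi); last exact: fin_proj_lub.
    by move=> P [hP _]; exact: proj_ge0.
  exact: fin_proj_directed.
have /lubT.2/(_ z) : forall A, (phi @` fin_proj) A -> bop_le A T.
  move=> _ [P [hP [s hs]] <-] x.
  have hp := endo_proj hP.
  have Pz : phi P z = 0.
    apply: dotp_eq0; rewrite dotp_nm -proj_dotp // hs endo_sum bop_sumE dotp_sumr.
    by rewrite big1.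
  (* As [phi P] kills [z], it sees only the component [T x] of [x], whose norm it does not
     increase. *)
  have -> : dotp x (phi P x) = (nm (phi P (T x)) ^+ 2)%:C.
    by rewrite proj_dotp // TE linearB linearZ /= Pz scaler0 subr0.
  by rewrite Tdotp lecR ler_sqr ?nnegrE ?nm_ge0// proj_le.
rewrite (endo_unital hphi) TE -[bop1 z]/z dotp_nm mulfV ?nm_sqrC_neq0 // scale1r subrr dotp0r.
rewrite lecR => h; suff : nm z == 0 by rewrite nm_eq0 (negPf z0).
by rewrite -sqrf_eq0 eq_le h sqr_ge0.
Qed.

Section Intertwiner.
Variables y w : H.

Lemma intertwiner_linear : linear (fun x => phi (rank1 x y) w).
Proof. by move=> a x x'; rewrite rank1_linearl (endo_linear hphi). Qed.

(** The product [rank1 y x \* rank1 x y] is [nm x ^+ 2] times [rank1 y y], so the bound follows from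
    the algebraic properties of [phi]. *)
Lemma intertwiner_bound x :
  nm (phi (rank1 x y) w) <= Num.sqrt (nm (dotp w (phi (rank1 y y) w))) * nm x.
Proof.
rewrite -ler_sqr ?nnegrE ?mulr_ge0 ?sqrtr_ge0 ?nm_ge0 // exprMn sqr_sqrtr ?nm_ge0 //.
rewrite -[X in X <= _]ger0_norm ?sqr_ge0 // -nm_real -dotp_nm adjE -(endo_adj hphi) adj_rank1.
rewrite -[phi _ (phi _ _)]/((phi _ \* phi _) w) -(endo_mul hphi) rank1M dotp_nm.
have -> : phi ((nm x ^+ 2)%:C *: rank1 y y) = (nm x ^+ 2)%:C *: phi (rank1 y y).
  rewrite -[_ *: rank1 y y]addr0 (endo_linear hphi); have := endo_sum [::] (fun _ : nat => 0).
  by rewrite !big_nil => ->; rewrite addr0.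
by rewrite bopZE dotpZr nmM nm_real ger0_norm ?sqr_ge0 // mulrC.
Qed.

Definition intertwiner : 'B(H) := mk_bop intertwiner_linear intertwiner_bound.

Lemma intertwinerP A : phi A \* intertwiner = intertwiner \* A.
Proof.
apply: bopP => x /=; rewrite -bopM_rank1 (endo_mul hphi) //.
Qed.

Lemma intertwiner_adjP A : adj intertwiner \* phi A = A \* adj intertwiner.
Proof. by rewrite -[A in RHS]adjK -adjM -intertwinerP adjM -(endo_adj hphi) adjK. Qed.

End Intertwiner.

Definition irreducible (G : set 'B(H)) : Prop :=
  forall X, (forall g, G g -> X \* g = g \* X) -> exists c : R[i], X = c *: bop1.

(* The vectors [phi (rank1 x y) w] are total and [x |-> phi (rank1 x y) w]
   intertwines [id] and [phi], so that [S^* C T] commutes with [G] for any two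
   such intertwiners [S] and [T]. *)
Lemma endo_commutant (G : set 'B(H)) C : irreducible G ->
  (forall g, G g -> C \* phi g = phi g \* C) -> forall A, C \* phi A = phi A \* C.
Proof.
move=> irrG hC A; pose D : 'B(H) := C \* phi A - phi A \* C.
have DE z : D z = C (phi A z) - phi A (C z) by rewrite bopBE.
have key (y w y' w' x x' : H) :
    dotp (phi (rank1 x y) w) (D (phi (rank1 x' y') w')) = 0.
  set S := intertwiner y w; set T := intertwiner y' w'.
  rewrite -[phi (rank1 x y) w]/(S x) -[phi (rank1 x' y') w']/(T x').
  have [c hc] : exists c : R[i], adj S \* C \* T = c *: bop1.
    apply: irrG => g Gg.
    rewrite -bopMA -intertwinerP bopMA -(bopMA (adj S)) hC // bopMA.
    by rewrite intertwiner_adjP !bopMA.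
  have hcE z : adj S (C (T z)) = c *: z.
    exact: (congr1 (fun X : 'B(H) => X z) hc).
  have TA z : phi A (T z) = T (A z).
    exact: (congr1 (fun X : 'B(H) => X z) (intertwinerP y' w' A)).
  have SA z : adj S (phi A z) = A (adj S z).
    exact: (congr1 (fun X : 'B(H) => X z) (intertwiner_adjP y w A)).
  rewrite DE adjE linearB /= TA SA !hcE linearZ /= subrr dotp0r //.
(* Totality is used twice: first [D] vanishes on the total vectors, then [adj D] vanishes
   everywhere. *)
have D0 y' w' x' : D (phi (rank1 x' y') w') = 0.
  by apply: endo_rank1_total => x y w; apply: dotp0C.
apply/eqP; rewrite -subr_eq0; apply/eqP; apply: bopP => x; apply: dotp_ext => z.
change (dotp z (D x) = dotp z 0); rewrite -adjE' dotp0r.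
suff -> : adj D z = 0 by rewrite dotp0l.
by apply: endo_rank1_total => x0 y w; rewrite adjE' D0 dotp0r.
Qed.

End Density.

(** * The invariant *)

Section Invariant.
Context {R : realType}.
Implicit Types H : hilbertType R.

(** Property I. The members of the ranges are given by preimages [S] and [T], and the intersection
    of the ranges enters only through its elements [Z]. *)
Definition relative_commutants_commute H (phi psi : 'B(H) -> 'B(H)) : Prop :=
  forall S T : 'B(H),
    (forall Z, range phi Z -> range psi Z ->
       phi S \* Z = Z \* phi S /\ psi T \* Z = Z \* psi T) ->
    phi S \* psi T = psi T \* phi S.

Lemma unitary_adj H H' (U : bop H H') : unitary U -> unitary (adj U).
Proof. by case=> h1 h2; split; rewrite adjK. Qed.

Lemma unitaryM H1 H2 H3 (U : bop H2 H3) (V : bop H1 H2) :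
  unitary U -> unitary V -> unitary (U \* V).
Proof.
move=> [U1 U2] [V1 V2]; split; rewrite adjM !bopMA.
  by rewrite -(bopMA _ (adj U)) U1 bopM1.
by rewrite -(bopMA _ V) V2 bopM1.
Qed.

Lemma conjugationM H H' (U : bop H H') (A B : 'B(H)) : unitary U ->
  conjugation U A \* conjugation U B = conjugation U (A \* B).
Proof.
move=> [U1 _]; rewrite /conjugation !bopMA.
by rewrite -(bopMA _ (adj U) U) U1 bopM1.
Qed.

Lemma conjugationK H H' (U : bop H H') (A : 'B(H)) : unitary U ->
  conjugation (adj U) (conjugation U A) = A.
Proof.
move=> [U1 _]; rewrite /conjugation adjK !bopMA U1 bop1M.
by rewrite -bopMA U1 bopM1.
Qed.

Lemma conjugationVK H H' (U : bop H H') (A : 'B(H')) : unitary U ->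
  conjugation U (conjugation (adj U) A) = A.
Proof.
move=> [_ U2]; rewrite /conjugation adjK !bopMA U2 bop1M.
by rewrite -bopMA U2 bopM1.
Qed.

Lemma conjugation_comp H1 H2 H3 (U : bop H2 H3) (V : bop H1 H2) A :
  conjugation U (conjugation V A) = conjugation (U \* V) A.
Proof. by rewrite /conjugation adjM !bopMA. Qed.

Lemma endo_conjugation H (phi : 'B(H) -> 'B(H)) U A : normal_unital_star_endo phi ->
  phi (conjugation U A) = conjugation (phi U) (phi A).
Proof. by move=> hphi; rewrite /conjugation !(endo_mul hphi) (endo_adj hphi). Qed.

Lemma relative_commutants_transport H H' (V : bop H' H)
    (phi psi : 'B(H) -> 'B(H)) (phi' psi' : 'B(H') -> 'B(H')) : unitary V ->
  (forall S, range phi (conjugation V (phi' S))) ->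
  (forall S, range psi (conjugation V (psi' S))) ->
  (forall S, range phi' (conjugation (adj V) (phi S))) ->
  (forall S, range psi' (conjugation (adj V) (psi S))) ->
  relative_commutants_commute phi psi -> relative_commutants_commute phi' psi'.
Proof.
move=> hV h1 h2 h1' h2' hc S T hST.
have [S' _ hS'] := h1 S; have [T' _ hT'] := h2 T.
have {hc} : phi S' \* psi T' = psi T' \* phi S'.
  apply: hc => Z [A _ hA] [B _ hB].
  have [] := hST (conjugation (adj V) Z); [by rewrite -hA; exact: h1'|by rewrite -hB; exact: h2'|].
  move=> /(congr1 (conjugation V)) hS /(congr1 (conjugation V)) hT.
  have VZ : conjugation V (conjugation (adj V) Z) = Z.
    exact: conjugationVK.
  by rewrite hS' hT'; move: hS hT; rewrite -!conjugationM // VZ.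
rewrite hS' hT' !conjugationM // => /(congr1 (conjugation (adj V))).
by rewrite !conjugationK.
Qed.

(* [beta_x (W_y)] is a unitary of the range of [beta_x], so [W_x] and
   [W_(x+y) = W_x beta_x (W_y)] conjugate this range to the same algebra; thus
   a single unitary works for [x] and [y]. *)
Lemma cocycle_conjugate_commutants d (P : set 'rV[R]_d) H H'
    (alpha : 'rV[R]_d -> 'B(H) -> 'B(H)) (beta : 'rV[R]_d -> 'B(H') -> 'B(H')) x y :
  P x -> P y -> P (x + y) -> E0_semigroup P alpha -> E0_semigroup P beta ->
  cocycle_conjugate P alpha beta ->
  relative_commutants_commute (alpha x) (alpha y) ->
  relative_commutants_commute (beta x) (beta y).
Proof.
move=> Px Py Pxy ha hb [U hU [W hW hp]].
have UW z : P z -> unitary (W z) by move=> Pz; exact: (cocycle_unitary hW).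
have alphaE z A : P z -> alpha z A =
    conjugation (adj U) (conjugation (W z) (beta z (conjugation U A))).
  by move=> Pz; have := hp z Pz (conjugation U A); rewrite conjugationK // => <-; rewrite conjugationK.
pose V := adj U \* W (x + y).
have hV : unitary V by apply: unitaryM; [exact: unitary_adj|exact: UW].
(* Used for both orders of [x] and [y]. Since [W (z + w) = W z \* beta z (W w)], conjugating
   [beta z S] by [W (x + y)] amounts to replacing [S] by its conjugate under [W w] and then
   conjugating by [W z]. *)
have fwd z w S : P z -> P w -> z + w = x + y ->
    range (alpha z) (conjugation V (beta z S)).
  move=> Pz Pw zw; exists (conjugation (adj U) (conjugation (W w) S)) => //.
  rewrite alphaE //.
  have -> : conjugation U (conjugation (adj U) (conjugation (W w) S)) = conjugation (W w) S.
    exact: conjugationVK.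
  rewrite endo_conjugation; last exact: (E0_endo hb).
  by rewrite (conjugation_comp (W z)) (cocycle_mul hW) // zw conjugation_comp.
have bwd z w S : P z -> P w -> z + w = x + y ->
    range (beta z) (conjugation (adj V) (alpha z S)).
  move=> Pz Pw zw; exists (conjugation (adj (W w)) (conjugation U S)) => //.
  have hbz := E0_endo hb Pz.
  rewrite alphaE // endo_conjugation // (endo_adj hbz) /V adjM adjK.
  rewrite -[in RHS](conjugation_comp (adj (W (x + y)))).
  have -> X : conjugation U (conjugation (adj U) X) = X.
    exact: conjugationVK.
  rewrite -zw -(cocycle_mul hW) // adjM -conjugation_comp conjugationK //.
  exact: UW.
apply: (relative_commutants_transport hV).
- by move=> S; exact: (fwd x y).
- by move=> S; apply: (fwd y x) => //; rewrite addrC.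
- by move=> S; exact: (bwd x y).
- by move=> S; apply: (bwd y x) => //; rewrite addrC.
Qed.

End Invariant.

(** * Range projections of a proper pair of isometries *)

Section Geometry.
Context {R : realType} {K : hilbertType R}.
Implicit Types V W : 'B(K).

Definition range_proj V : 'B(K) := V \* adj V.

Lemma range_projE V x : range_proj V x = V (adj V x). Proof. by []. Qed.

Lemma adj_isoK V x : isometry V -> adj V (V x) = x.
Proof. by move=> /isometry_adj h; exact: (congr1 (fun A : 'B(K) => A x) h). Qed.

Lemma range_proj_is_proj V : isometry V -> is_proj (range_proj V).
Proof.
move=> hV; split; first by rewrite /range_proj adjM adjK.
by apply: bopP => x; rewrite /= adj_isoK.
Qed.

Lemma range_proj_id V x : isometry V -> range_proj V (V x) = V x.
Proof. by move=> hV; rewrite range_projE adj_isoK. Qed.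

Lemma range_proj_orth V x : (forall z, dotp (V z) x = 0) -> range_proj V x = 0.
Proof.
move=> h; rewrite range_projE.
by have -> : adj V x = 0 by [apply: dotp_eq0; rewrite -adjE h]; rewrite linear0.
Qed.

(** The left side of the last hypothesis is self-adjoint, hence so is [P \* Q]. *)
Lemma proj_comm (P Q : 'B(K)) : is_proj P -> is_proj Q ->
  Q \* (P \* Q) = P \* Q -> P \* Q = Q \* P.
Proof.
move=> [aP _] [aQ _] h.
by have := congr1 adj h; rewrite !adjM aP aQ -bopMA h.
Qed.

Lemma proj_sym (P : 'B(K)) x y : is_proj P -> dotp (P x) y = dotp x (P y).
Proof. by move=> hP; rewrite adjE hP.1. Qed.

Lemma proj_diff (P Q : 'B(K)) : is_proj P -> is_proj Q ->
  P \* Q = Q \* P -> is_proj (Q - Q \* P).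
Proof.
move=> hP hQ PQ.
have PQE x : P (Q x) = Q (P x) by exact: (congr1 (fun A : 'B(K) => A x) PQ).
set D := Q - _; have DE x : D x = Q x - Q (P x) by rewrite bopBE.
split.
  apply: adj_eq => x y; rewrite !DE dotpBl dotpBr !(proj_sym _ _ hQ) (proj_sym _ _ hP).
  by rewrite PQE.
apply: bopP => x; rewrite -[LHS]/(D (D x)) !DE !bopBr PQE !projM //.
by rewrite PQE !projM // subrr subr0.
Qed.

Section TwoIsometries.
Variables V W : 'B(K).
Hypotheses (hV : isometry V) (hW : isometry W) (VW : V \* W = W \* V).
(** As [V] and [W] commute, [A] and [B] are the orthogonal complements of the range of [V \* W] in
    the ranges of [V] and [W]. Thus [orthAB] says that these two ranges are orthogonal apart from
    their intersection. *)
Let A := V @` [set xi | adj W xi = 0].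
Let B := W @` [set xi | adj V xi = 0].
Let L := A `&` B.
Hypothesis orthAB : orthogonal_sets (A `&` orthocompl L) (B `&` orthocompl L).

Let VWE x : V (W x) = W (V x).
Proof. exact: (congr1 (fun X : 'B(K) => X x) VW). Qed.

Let L_subspace : linear_subspace L.
Proof.
split; first by split; exists 0; rewrite /= ?linear0.
move=> a _ _ [[u hu <-] [v hv uv]] [[u' hu' <-] [v' hv' uv']]; split.
  by exists (a *: u + u'); rewrite /= !linearP //= hu hu' scaler0 addr0.
by exists (a *: v + v'); rewrite /= !linearP /= ?hv ?hv' ?scaler0 ?addr0 // uv uv'.
Qed.

Let L_closed u : approx L u -> L u.
Proof.
move=> Lu.
have cl (S T : 'B(K)) : isometry S -> (forall s, L s -> exists2 z, adj T z = 0 & S z = s) ->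
    exists2 z, adj T z = 0 & S z = u.
  move=> hS h; exists (adj S u).
    apply: dotp_ext => z; rewrite -adjE -adjE dotp0r.
    apply: dotp0C; apply: (approx_dotp0 Lu) => s /h[w Tw <-].
    by rewrite isometry_dotp // -adjE' Tw dotp0l.
  apply: dotp_ext => z; apply/eqP; rewrite -subr_eq0; apply/eqP.
  rewrite -adjE' -adjE -dotpBl; apply: dotp0C; apply: (approx_dotp0 Lu) => s /h[w _ <-].
  by rewrite dotpBr isometry_dotp // -adjE subrr.
by split; [apply: (cl V W hV) => s []|apply: (cl W V hW) => s []].
Qed.

Let L_split x : exists2 l, L l & orthocompl L (x - l).
Proof.
have [l al ol] := orth_projection x L_subspace.
by exists l; [exact: L_closed|move=> s; exact: ol].
Qed.

Let orth_AB a b : A a -> (B `&` orthocompl L) b -> dotp a b = 0.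
Proof.
move=> Aa hb; have [l Ll ol] := L_split a.
rewrite -[a](subrK l) dotpDl (hb.2 l) // addr0; apply: orthAB => //; split=> //.
have [u hu uE] := Aa; have [[v hv vE] _] := Ll.
by exists (u - v); rewrite /= ?linearB /= ?hu ?hv ?subrr // uE vE.
Qed.

(** [W x] splits along [L], the part of [B] orthogonal to [L], and the range of [V \* W]. The
    projection onto the range of [V] kills the second component and fixes the two others, which also
    lie in the range of [W]. *)
Let proj_swap x : range_proj W (range_proj V (W x)) = range_proj V (W x).
Proof.
pose k := x - range_proj V x.
have Vk : adj V k = 0 by rewrite /k range_projE linearB /= adj_isoK // subrr.
have [l Ll ol] := L_split (W k).
set b := W k - l in ol.
have [[l' hl' l'E] [l'' hl'' l''E]] := Ll.
have Bb : (B `&` orthocompl L) b.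
  by split=> //; exists (k - l''); rewrite /b /= linearB /= ?l''E // Vk hl'' subrr.
have pb : range_proj V b = 0.
  apply: range_proj_orth => z.
  (* The first summand lies in [A]; the second is orthogonal to [b] because [b] is the image under
     [W] of a vector of the kernel of [adj V]. *)
  have -> : V z = V (z - range_proj W z) + W (V (adj W z)).
    by rewrite -VWE -linearD /= -range_projE subrK.
  rewrite dotpDl.
  rewrite orth_AB ?add0r //; last first.
    by exists (z - range_proj W z); rewrite //= linearB /= adj_isoK // subrr.
  have [[v hv <-] _] := Bb.
  by rewrite isometry_dotp // adjE hv dotp0r.
have -> : W x = l + b + V (W (adj V x)).
  by rewrite VWE addrC -[l + b]addrC subrK -linearD /= -range_projE addrC /k subrK.
rewrite (bopDr (range_proj V)) (bopDr (range_proj V) l) pb addr0.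
rewrite -[in range_proj V l]l'E !range_proj_id // l'E.
by rewrite bopDr -{1}l''E range_proj_id // l''E VWE range_proj_id.
Qed.

Lemma proper_range_proj_comm : range_proj V \* range_proj W = range_proj W \* range_proj V.
Proof.
apply: proj_comm; [exact: range_proj_is_proj|exact: range_proj_is_proj|].
by apply: bopP => z; exact: proj_swap.
Qed.

(** Any nonzero vector of [A] orthogonal to [L] works: the range of [W] is spanned by the range of
    [V \* W], [L] and the part of [B] orthogonal to [L], and the vector is orthogonal to all
    three. *)
Lemma proper_range_proj_witness : A `&` orthocompl L <> [set 0] ->
  exists2 xi, xi != 0 & range_proj V xi = xi /\ range_proj W xi = 0.
Proof.
move=> hA; have [xi [Axi oxi] xi0] : exists2 xi, (A `&` orthocompl L) xi & xi != 0.
  apply: contrapT => h; apply: hA; apply/seteqP; split=> [x hx /=|_ ->].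
    by apply: contrapT => /eqP x0; apply: h; exists x.
  split; last by move=> s _; rewrite dotp0r.
  by exists 0; rewrite /= ?linear0.
exists xi => //; have [u hu uE] := Axi.
split; first by rewrite -uE range_proj_id.
apply: range_proj_orth => z.
have -> : W z = W (z - range_proj V z) + V (W (adj V z)).
  by rewrite VWE -linearD /= -range_projE subrK.
have h : dotp (V (W (adj V z))) xi = 0 by rewrite -uE isometry_dotp // adjE hu dotp0r.
rewrite dotpDl h addr0 range_projE.
have [l Ll ol] := L_split (W (z - V (adj V z))).
rewrite -[W _](subrK l) dotpDl (oxi l) // addr0.
have [_ [l'' hl'' l''E]] := Ll.
apply: dotp0C; apply: orth_AB => //; split=> //.
exists (z - V (adj V z) - l''); rewrite /= !linearB /= ?l''E //.
by rewrite adj_isoK // subrr hl'' subrr.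
Qed.

End TwoIsometries.
End Geometry.

(** * Canonical anticommutation relations *)

Section Fermi.
Context {R : realType} {K : hilbertType R} (G : altFock K).
Implicit Types (f g h : K) (s t : seq K).

(** Freeing the matrix dimension from [size s] avoids casts between equal sizes. *)
Lemma alt_gramE n s t : size s = n -> size t = n ->
  alt_gram s t = \det (\matrix_(i < n, j < n) dotp s`_i t`_j).
Proof. by move=> <- st; rewrite /alt_gram st eqxx. Qed.

Lemma alt_gram_size s t : size s != size t -> alt_gram s t = 0.
Proof. by rewrite /alt_gram => /negPf ->. Qed.

Lemma wedge_approx (x : G) : approx (lspan (range (wedge G))) x.
Proof. exact/dense_approx/wedge_total. Qed.

Lemma wedge_orth (x : G) : (forall s, dotp (wedge G s) x = 0) -> x = 0.
Proof. by move=> h; apply: (total_orth wedge_approx) => _ [s _ <-]. Qed.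

Lemma wedge_ext (x y : G) : (forall s, dotp (wedge G s) x = dotp (wedge G s) y) -> x = y.
Proof.
move=> h; apply/eqP; rewrite -subr_eq0; apply/eqP/wedge_orth => s.
by rewrite dotpBr h subrr.
Qed.

Lemma bop_wedge_eq (H : hilbertType R) (A B : bop G H) :
  (forall s, A (wedge G s) = B (wedge G s)) -> A = B.
Proof. by move=> h; apply: (bop_total_eq wedge_approx) => _ [s _ <-]. Qed.

Lemma wedge_map_adj (A : 'B(K)) s t :
  dotp (wedge G (map A s)) (wedge G t) = dotp (wedge G s) (wedge G (map (adj A) t)).
Proof.
rewrite !wedge_dotp; have [st|st] := eqVneq (size s) (size t); last first.
  by rewrite !alt_gram_size ?size_map.
rewrite !(@alt_gramE (size s)) ?size_map //; congr (\det _).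
apply/matrixP => i j; rewrite !mxE !(nth_map 0) -?st // ?adjE //.
Qed.

(* [<X', X'> = <X', X>] because [Q] is a self-adjoint idempotent. *)
Lemma wedge_proj_contraction (Q : 'B(K)) (c : seq (R[i] * seq K)) : is_proj Q ->
  nm (\sum_(p <- c) p.1 *: wedge G (map Q p.2)) <= nm (\sum_(p <- c) p.1 *: wedge G p.2).
Proof.
move=> hQ; set X' := (X in nm X <= _); set X := (X in _ <= nm X).
have XX : dotp X' X' = dotp X' X.
  rewrite /X' /X !dotp_suml; apply: eq_bigr => p _; rewrite !dotp_sumr; apply: eq_bigr => q _.
  rewrite !dotpZl !dotpZr; congr (_ * (_ * _)).
  rewrite !wedge_map_adj hQ.1 -map_comp.
  by congr (dotp _ (wedge G _)); apply: eq_map => x /=; rewrite projM.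
have [->|X0] := eqVneq X' 0; first by rewrite nm0 nm_ge0.
have nX : 0 < nm X' by rewrite nm_gt0.
rewrite -(ler_pM2l nX) -expr2 -[X in X <= _]ger0_norm ?sqr_ge0 // -nm_real -dotp_nm XX.
exact: cauchy_schwarz.
Qed.

Lemma det_schur n (u : 'rV[R[i]]_n) (v : 'cV[R[i]]_n) (B : 'M[R[i]]_n) :
  \det (block_mx 1%:M u v B) = \det (B - v *m u).
Proof.
have -> : block_mx 1%:M u v B =
    block_mx 1%:M 0 v 1%:M *m block_mx 1%:M u 0 (B - v *m u).
  by rewrite mulmx_block !mul1mx !mul0mx !mulmx1 !addr0 addrC subrK.
by rewrite det_mulmx det_lblock det_ublock !det1 !mul1r.
Qed.

Lemma unit_proj f : nm f = 1 -> is_proj (bop1 - rank1 f f).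
Proof.
set Q := (X in is_proj X) => f1; have QE x : Q x = x - dotp f x *: f by rewrite bopBE.
split.
  by apply: adj_eq => x y; rewrite !QE dotpBl dotpBr dotpZl dotpZr -dotp_conj mulrC.
apply: bopP => x; rewrite -[LHS]/(Q (Q x)) !QE.
by rewrite dotpBr dotpZr dotp_nm f1 expr1n mulr1 subrr scale0r subr0.
Qed.

(** The Gram matrix has the pivot [dotp f f = 1], and its Schur complement is the Gram matrix after
    projecting [f] away. *)
Lemma wedge_cons_dotp f s t : nm f = 1 ->
  dotp (wedge G (f :: s)) (wedge G (f :: t)) =
  dotp (wedge G (map (bop1 - rank1 f f : 'B(K)) s)) (wedge G (map (bop1 - rank1 f f : 'B(K)) t)).
Proof.
move=> f1; have hQ := unit_proj f1; set Q := (X in is_proj X) in hQ.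
have QE x : Q x = x - dotp f x *: f by rewrite bopBE.
have QQ : map Q (map Q t) = map Q t by rewrite -map_comp; apply: eq_map => x; exact: projM.
rewrite wedge_map_adj hQ.1 QQ !wedge_dotp.
have [st|st] := eqVneq (size s) (size t); last first.
  by rewrite !alt_gram_size //= ?size_map ?eqSS.
rewrite (@alt_gramE (1 + size s)) /= ?st // (@alt_gramE (size s)) ?size_map // -st.
pose u : 'rV[R[i]]_(size s) := \row_j dotp f t`_j.
pose v : 'cV[R[i]]_(size s) := \col_i dotp s`_i f.
pose B : 'M[R[i]]_(size s) := \matrix_(i, j) dotp s`_i t`_j.
transitivity (\det (block_mx 1%:M u v B)).
  congr (\det _); apply/matrixP => i j; rewrite !mxE.
  case: splitP => i' /= ->; rewrite !mxE; case: splitP => j' /= ->; rewrite ?mxE ?ord1 //=.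
  by rewrite dotp_nm f1 expr1n.
rewrite det_schur; congr (\det _); apply/matrixP => i j.
rewrite !mxE big_ord1 !mxE (nth_map 0) -?st // scaleN1r dotpBr dotpZr.
by rewrite mulrC.
Qed.

(** [bump j] is the index map of the minors in a cofactor expansion, so these minors are again Gram
    matrices. *)
Definition del j t : seq K := mkseq (fun k => t`_(bump j k)) (size t).-1.

Lemma del_cons j h t : (j < size t)%N -> del j.+1 (h :: t) = h :: del j t.
Proof.
case: t => // h' t _; rewrite /del /= /mkseq /=; congr (_ :: _).
rewrite -[1%N]/(1 + 0)%N iotaDl -map_comp; apply: eq_map => k /=.
by rewrite bumpS.
Qed.

Lemma del0_cons h t : del 0 (h :: t) = t.
Proof.
apply: (@eq_from_nth _ 0); rewrite size_mkseq //= => i it.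
by rewrite nth_mkseq.
Qed.

(** Laplace expansion of the Gram determinant along its first row. *)
Lemma wedge_dotp_expand f s t :
  dotp (wedge G (f :: s)) (wedge G t) =
  \sum_(j < size t) (-1) ^+ j * dotp f t`_j * dotp (wedge G s) (wedge G (del j t)).
Proof.
rewrite wedge_dotp; have [st|st] := eqVneq (size s).+1 (size t); last first.
  (* Deleting an entry preserves the mismatch of lengths: the index [j] shows that [t] is nonempty,
     so its length does drop by one. *)
  rewrite alt_gram_size //= big1 // => j _; rewrite wedge_dotp alt_gram_size ?mulr0 //.
  by rewrite size_mkseq; apply: contraNneq st => ->; rewrite prednK // (leq_trans _ (ltn_ord j)).
rewrite (@alt_gramE (size s).+1) /= -?st //.
rewrite (expand_det_row _ ord0); apply: eq_bigr => j _.
rewrite !mxE /= -mulrA mulrCA; congr (_ * _).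
rewrite /cofactor; congr (_ * _).
rewrite wedge_dotp (@alt_gramE (size s)) ?size_mkseq -?st //; congr (\det _).
by apply/matrixP => i k; rewrite !mxE /= nth_mkseq // -st.
Qed.

Lemma wedge_linear (a : R[i]) f g s :
  wedge G ((a *: f + g) :: s) = a *: wedge G (f :: s) + wedge G (g :: s).
Proof.
apply: wedge_ext => t; apply: (can_inj (@conjcK R)).
rewrite -!dotp_conj dotpDl dotpZl !wedge_dotp_expand mulr_sumr -big_split /=.
by apply: eq_bigr => j _; rewrite dotpDl dotpZl; ring.
Qed.

Lemma wedgeZ (a : R[i]) f s : wedge G (a *: f :: s) = a *: wedge G (f :: s).
Proof.
have h : wedge G (0 :: s) = 0.
  by have := wedge_linear (-1) 0 0 s; rewrite scaler0 addr0 scaleN1r addNr.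
by rewrite -[a *: f]addr0 wedge_linear h addr0.
Qed.

(** For unit [f], [wedge_cons_dotp] gives the left vector the norm of the image of the right one
    under a second-quantized projection, which is a contraction. *)
Lemma creation_bound f (c : seq (R[i] * seq K)) :
  nm (\sum_(p <- c) p.1 *: wedge G (f :: p.2)) <= nm f * nm (\sum_(p <- c) p.1 *: wedge G p.2).
Proof.
have [->|f0] := eqVneq f 0.
  rewrite big1 ?nm0 ?mul0r // => p _.
  by rewrite -(scale0r (0 : K)) wedgeZ scale0r scaler0.
have nf0 : (nm f)%:C != 0 :> R[i] by rewrite (inj_eq (@complexI R) _ 0) nm_eq0.
pose f' := ((nm f)^-1)%:C *: f.
have f'1 : nm f' = 1 by rewrite nmZ nm_real ger0_norm ?invr_ge0 ?nm_ge0 // mulVf // nm_eq0.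
have -> : \sum_(p <- c) p.1 *: wedge G (f :: p.2) =
    (nm f)%:C *: \sum_(p <- c) p.1 *: wedge G (f' :: p.2).
  rewrite scaler_sumr; apply: eq_bigr => p _; rewrite wedgeZ !scalerA; congr (_ *: _).
  by rewrite mulrAC -rmorphM /= divff ?nm_eq0 // mul1r.
rewrite nmZ nm_real ger0_norm ?nm_ge0 // ler_wpM2l ?nm_ge0 //.
have hQ := unit_proj f'1; apply: le_trans (wedge_proj_contraction c hQ).
rewrite -ler_sqr ?nnegrE ?nm_ge0 // -lecR -!dotp_nm.
suff -> : dotp (\sum_(p <- c) p.1 *: wedge G (f' :: p.2)) (\sum_(p <- c) p.1 *: wedge G (f' :: p.2)) =
  dotp (\sum_(p <- c) p.1 *: wedge G (map (bop1 - rank1 f' f' : 'B(K)) p.2))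
    (\sum_(p <- c) p.1 *: wedge G (map (bop1 - rank1 f' f' : 'B(K)) p.2)) by [].
rewrite !dotp_suml; apply: eq_bigr => p _; rewrite !dotp_sumr; apply: eq_bigr => q _.
by rewrite !dotpZl !dotpZr wedge_cons_dotp.
Qed.

Lemma creationE f s : creation G f (wedge G s) = wedge G (f :: s).
Proof.
rewrite /creation; case: xgetP => [T _ hT|h]; first exact: hT.
have [T hT] := total_extend (f := fun s => wedge G (f :: s)) (nm_ge0 f) wedge_approx (creation_bound f).
by have := h T hT.
Qed.

Lemma creation_linear (a : R[i]) f g :
  creation G (a *: f + g) = a *: creation G f + creation G g.
Proof.
by apply: bop_wedge_eq => s; rewrite bopDE bopZE !creationE wedge_linear.
Qed.

Lemma creationD f g : creation G (f + g) = creation G f + creation G g.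
Proof. by rewrite -[f in LHS]scale1r creation_linear scale1r. Qed.

Lemma creationN f : creation G (- f) = - creation G f.
Proof.
by apply: bop_wedge_eq => s; rewrite -[- creation G f]scaleN1r bopZE !creationE -wedgeZ scaleN1r.
Qed.

Lemma annihilation_wedge f t : annihilation G f (wedge G t) =
  \sum_(j < size t) ((-1) ^+ j * dotp f t`_j) *: wedge G (del j t).
Proof.
apply: wedge_ext => s; rewrite /annihilation -adjE creationE wedge_dotp_expand dotp_sumr.
by apply: eq_bigr => j _; rewrite dotpZr.
Qed.

(** On [h :: t], the term [j = 0] of [annihilation_wedge] gives the scalar; in the others the index
    is shifted by one, which reverses the sign. *)
Lemma CAR f h x : annihilation G f (creation G h x) =
  dotp f h *: x - creation G h (annihilation G f x).
Proof.
suff E : annihilation G f \* creation G h = dotp f h *: bop1 - creation G h \* annihilation G f.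
  by have := congr1 (fun A : 'B(G) => A x) E; rewrite bopBE bopZE.
apply: bop_wedge_eq => t; rewrite bopBE bopZE /= creationE !annihilation_wedge.
rewrite big_ord_recl /= mul1r del0_cons; congr (_ + _).
rewrite linear_sum /= -sumrN; apply: eq_bigr => j _.
by rewrite bopZr creationE del_cons // /bump /= add1n exprS mulN1r mulNr scaleNr.
Qed.

Lemma creation_anticomm f g x :
  creation G f (creation G g x) = - creation G g (creation G f x).
Proof.
suff E : creation G f \* creation G g = - (creation G g \* creation G f).
  by have := congr1 (fun A : 'B(G) => A x) E; rewrite -scaleN1r bopZE scaleN1r.
apply: bop_wedge_eq => s; rewrite -scaleN1r bopZE scaleN1r /= !creationE.
apply/eqP; rewrite -subr_eq0 opprK; apply/eqP.
(* A repeated factor gives two equal rows; expanding this identity for [f + g] yields the sign. *)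
have sq h : wedge G [:: h, h & s] = 0.
  apply: dotp_eq0; rewrite wedge_dotp (@alt_gramE (size s).+2) //.
  rewrite (determinant_alternate (i1 := ord0) (i2 := lift ord0 ord0)) // => j.
  by rewrite !mxE.
have lin h k l : wedge G [:: h, k + l & s] = wedge G [:: h, k & s] + wedge G [:: h, l & s].
  by rewrite -!creationE -!bopDr creationD.
have linl h k t : wedge G (h + k :: t) = wedge G (h :: t) + wedge G (k :: t).
  by rewrite -!creationE creationD.
by have := sq (f + g); rewrite lin !linl !sq add0r addr0 addrC.
Qed.

End Fermi.

(** * Irreducibility of the CAR and second-quantized reflections *)

Section FermiReflections.
Context {R : realType} {K : hilbertType R} (G : altFock K).
Implicit Types (f g h u : K) (s t : seq K) (Q : 'B(K)).

Local Notation "a+ f" := (creation G f) (at level 8, f at level 8).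
Local Notation "a- f" := (annihilation G f) (at level 8, f at level 8).
Local Notation Om := (wedge G [::]).

Lemma wedge_nil_dotp : dotp Om Om = 1.
Proof. by rewrite wedge_dotp (@alt_gramE _ _ 0) // det_mx00. Qed.

Lemma vacuum_neq0 : Om != 0.
Proof.
apply/eqP => h; have := wedge_nil_dotp; rewrite h dotp0l => /esym/eqP.
by rewrite oner_eq0.
Qed.

Lemma annihilation_vacuum f : a- f Om = 0.
Proof. by rewrite annihilation_wedge big_ord0. Qed.

Lemma vacuum_unique (x : G) : (forall f, a- f x = 0) -> x = dotp Om x *: Om.
Proof.
move=> h; apply: wedge_ext => -[|f s]; first by rewrite dotpZr wedge_nil_dotp mulr1.
rewrite dotpZr -!creationE !adjE -/(annihilation G f) h annihilation_vacuum.
by rewrite !dotp0r mulr0.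
Qed.

Definition CAR_generators : set 'B(G) := [set A | exists f, A = a+ f \/ A = a- f].

(** The annihilation operators kill [X Om], so it is a multiple of the vacuum; creation operators
    carry the scalar to all decomposable vectors. *)
Lemma CAR_irreducible : irreducible CAR_generators.
Proof.
move=> X hX.
have hc f x : X (a+ f x) = a+ f (X x).
  by have := congr1 (fun A : 'B(G) => A x) (hX (a+ f) (ex_intro _ f (or_introl erefl))).
have ha f x : X (a- f x) = a- f (X x).
  by have := congr1 (fun A : 'B(G) => A x) (hX (a- f) (ex_intro _ f (or_intror erefl))).
exists (dotp Om (X Om)); apply: bop_wedge_eq => s; rewrite bopZE.
elim: s => [|f s IH].
  by apply: vacuum_unique => f; rewrite -ha annihilation_vacuum linear0.
by rewrite -creationE hc IH bopZr.
Qed.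

(** It is [-1] on the range of [Q] and [1] on the kernel; for [Q = bop1] its second quantization is
    the parity operator. *)
Definition reflection Q : 'B(K) := bop1 - 2%:R *: Q.

Lemma reflectionE Q f : reflection Q f = f - 2%:R *: Q f.
Proof. by rewrite bopBE bopZE. Qed.

Lemma reflectionK Q f : is_proj Q -> reflection Q (reflection Q f) = f.
Proof.
move=> hQ; rewrite !reflectionE bopBr bopZr projM //.
rewrite -[X in _ *: (X - _)]scale1r -scalerBl scalerA -addrA -opprD -scalerDl.
by rewrite (_ : 2%:R + _ = 0) ?scale0r ?subr0 //; ring.
Qed.

Lemma adj_reflection Q : is_proj Q -> adj (reflection Q) = reflection Q.
Proof.
move=> hQ; apply: adj_eq => x y; rewrite !reflectionE dotpBl dotpBr dotpZl dotpZr.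
by rewrite adjE hQ.1 rmorph_nat.
Qed.

Lemma second_quant_exists Q : is_proj Q ->
  exists T : 'B(G), forall s, T (wedge G s) = wedge G (map (reflection Q) s).
Proof.
move=> hQ; apply: (total_extend (f := fun s => wedge G (map (reflection Q) s)) ler01 (@wedge_approx _ _ G)).
move=> c; rewrite mul1r -ler_sqr ?nnegrE ?nm_ge0 // -lecR -!dotp_nm.
rewrite (_ : dotp _ _ = dotp (\sum_(p <- c) p.1 *: wedge G p.2) (\sum_(p <- c) p.1 *: wedge G p.2)) //.
rewrite !dotp_suml; apply: eq_bigr => p _; rewrite !dotp_sumr; apply: eq_bigr => q _.
rewrite !dotpZl !dotpZr wedge_map_adj adj_reflection // -map_comp.
by rewrite [map _ q.2](@eq_map _ _ _ id) ?map_id // => x; exact: reflectionK.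
Qed.

Section SecondQuant.
Variables (Q : 'B(K)) (T : 'B(G)).
Hypothesis hQ : is_proj Q.
Hypothesis hT : forall s, T (wedge G s) = wedge G (map (reflection Q) s).

Lemma second_quant_adj : adj T = T.
Proof.
apply: bop_wedge_eq => s; apply: wedge_ext => t.
by rewrite -adjE !hT wedge_map_adj adj_reflection.
Qed.

Lemma second_quantK x : T (T x) = x.
Proof.
suff E : T \* T = bop1 by have := congr1 (fun A : 'B(G) => A x) E.
apply: bop_wedge_eq => s; rewrite /= !hT -map_comp.
by rewrite [map _ s](@eq_map _ _ _ id) ?map_id // => y; exact: reflectionK.
Qed.

Lemma second_quant_creation f x : T (a+ f x) = a+ (reflection Q f) (T x).
Proof.
suff E : T \* a+ f = a+ (reflection Q f) \* T by have := congr1 (fun A : 'B(G) => A x) E.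
by apply: bop_wedge_eq => s; rewrite /= !(creationE, hT).
Qed.

Lemma second_quant_annihilation f x : T (a- f x) = a- (reflection Q f) (T x).
Proof.
have l (u v : G) : dotp (T u) v = dotp u (T v) by rewrite adjE second_quant_adj.
apply: dotp_ext => z; rewrite -l /annihilation -!adjE -l.
by rewrite second_quant_creation reflectionK.
Qed.

Lemma reflection_fixed f : Q f = 0 -> reflection Q f = f.
Proof. by rewrite reflectionE => ->; rewrite scaler0 subr0. Qed.

Lemma reflection_opp f : Q f = f -> reflection Q f = - f.
Proof. by rewrite reflectionE => ->; rewrite scaler_nat mulr2n opprD addrA subrr add0r. Qed.

End SecondQuant.
End FermiReflections.

(** * The image of the parity operator under an endomorphism *)

Section FermiEndomorphisms.
Context {R : realType} {K : hilbertType R} (G : altFock K).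
Implicit Types (f u w : K) (phi psi : 'B(G) -> 'B(G)).

Local Notation "a+ f" := (creation G f) (at level 8, f at level 8).
Local Notation "a- f" := (annihilation G f) (at level 8, f at level 8).
Local Notation Om := (wedge G [::]).

Lemma annihilationD f g : a- (f + g) = a- f + a- g.
Proof.
rewrite /annihilation creationD; apply: adj_eq => x y.
by rewrite !bopDE dotpDl dotpDr !adjE.
Qed.

Lemma annihilationN f : a- (- f) = - a- f.
Proof.
rewrite /annihilation creationN; apply: adj_eq => x y.
by rewrite !bopNE dotpNl dotpNr !adjE.
Qed.

Lemma annihilation_anticomm f g x : a- f (a- g x) = - a- g (a- f x).
Proof.
apply: dotp_ext => z; rewrite dotpNr /annihilation -!adjE creation_anticomm.
by rewrite dotpNl.
Qed.

Lemma bop_comm_at (A B : 'B(G)) : A \* B = B \* A -> forall x, A (B x) = B (A x).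
Proof. by move=> h x; exact: (congr1 (fun X : 'B(G) => X x) h). Qed.

Variable Gam : 'B(G).
Hypothesis hGam : forall s, Gam (wedge G s) = wedge G (map (reflection (bop1 : 'B(K))) s).

Let GamK := second_quantK (proj1 (H := K)) hGam.

Let Gamc f x : Gam (a+ f x) = - a+ f (Gam x).
Proof.
by rewrite (second_quant_creation hGam) reflection_opp // creationN bopNE.
Qed.

Let Gama f x : Gam (a- f x) = - a- f (Gam x).
Proof.
by rewrite (second_quant_annihilation (proj1 (H := K)) hGam) reflection_opp // annihilationN bopNE.
Qed.

Section OneEndo.
Variables (phi : 'B(G) -> 'B(G)) (V : 'B(K)).
Hypotheses (hphi : normal_unital_star_endo phi) (hV : isometry V).
Hypothesis phia : forall u, phi (a- u) = a- (V u).

Lemma phic u : phi (a+ u) = a+ (V u).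
Proof. by rewrite -[a+ u]adjK (endo_adj hphi) -/(annihilation G u) phia /annihilation adjK. Qed.

Lemma CAR_commutant (C : 'B(G)) : (forall u x, C (a+ (V u) x) = a+ (V u) (C x)) ->
  (forall u x, C (a- (V u) x) = a- (V u) (C x)) -> forall A, C \* phi A = phi A \* C.
Proof.
move=> hc ha; apply: (endo_commutant hphi (@CAR_irreducible _ _ G)) => _ [f [->|->]].
  by rewrite phic; apply: bopP => x /=; rewrite hc.
by rewrite phia; apply: bopP => x /=; rewrite ha.
Qed.

(** Up to a scalar, this is the parity of the range of [V]: it anticommutes with the generators from
    that range and commutes with those from its orthogonal complement. *)
Definition parity_image : 'B(G) := phi Gam.
Local Notation g := parity_image.

Lemma endoM_at A B x : phi (A \* B) x = phi A (phi B x).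
Proof. by rewrite (endo_mul hphi). Qed.

Lemma endoN A : phi (- A) = - phi A.
Proof.
have := endo_linear hphi (-1) A 0; rewrite addr0 !scaleN1r => ->.
by have := endo_sum hphi [::] (fun _ : nat => 0); rewrite !big_nil => ->; rewrite addr0.
Qed.

Lemma parityK x : g (g x) = x.
Proof.
rewrite -endoM_at; have -> : Gam \* Gam = bop1 by apply: bopP => z; exact: GamK.
by rewrite (endo_unital hphi).
Qed.

Lemma parity_creation_range u x : g (a+ (V u) x) = - a+ (V u) (g x).
Proof.
rewrite -phic -!endoM_at -bopNE -endoN; congr (phi _ x).
by apply: bopP => z; rewrite bopNE; exact: Gamc.
Qed.

Lemma parity_annihilation_range u x : g (a- (V u) x) = - a- (V u) (g x).
Proof.
rewrite -phia -!endoM_at -bopNE -endoN; congr (phi _ x).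
by apply: bopP => z; rewrite bopNE; exact: Gama.
Qed.

(** [g \* Gam] commutes with the generators from the range of [V], hence with [g], which lies in the
    range of [phi]; since [g] squares to the identity, [g] and [Gam] commute. *)
Lemma parity_comm x : g (Gam x) = Gam (g x).
Proof.
have h : (g \* Gam) \* g = g \* (g \* Gam).
  apply: CAR_commutant => u z /=.
    by rewrite Gamc bopNr parity_creation_range opprK.
  by rewrite Gama bopNr parity_annihilation_range opprK.
have := congr1 (fun A : 'B(G) => g (A x)) h; rewrite /= !parityK.
by move=> ->.
Qed.

Section Defect.
Variable u : K.
Hypothesis pu : range_proj V u = 0.

Lemma defect_dotp w : dotp u (V w) = 0.
Proof.
rewrite -(range_proj_id w hV) -adjE' (range_proj_is_proj hV).1 pu dotp0l //.
Qed.

(** The factor [Gam] turns anticommutation with the generators from the range of [V] into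
    commutation, so [a+ u \* Gam] commutes with [g]; [parity_comm] then removes [Gam]. *)
Lemma parity_creation_defect x : g (a+ u x) = a+ u (g x).
Proof.
have h : (a+ u \* Gam) \* g = g \* (a+ u \* Gam).
  apply: CAR_commutant => w z /=.
    by rewrite Gamc bopNr creation_anticomm opprK.
  by rewrite Gama bopNr CAR (dotp0C (defect_dotp w)) scale0r sub0r.
have := congr1 (fun A : 'B(G) => A (Gam x)) h; rewrite /=.
by rewrite -parity_comm GamK.
Qed.

Lemma parity_annihilation_defect x : g (a- u x) = a- u (g x).
Proof.
have h : (a- u \* Gam) \* g = g \* (a- u \* Gam).
  apply: CAR_commutant => w z /=.
    by rewrite Gamc bopNr CAR defect_dotp scale0r sub0r opprK.
  by rewrite Gama bopNr annihilation_anticomm opprK.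
have := congr1 (fun A : 'B(G) => A (Gam x)) h; rewrite /=.
by rewrite -parity_comm GamK.
Qed.

End Defect.

(** Splitting [f] along the range of [V] shows that every [a- f] kills [g Om]; the scalar is nonzero
    because [g] is invertible. *)
Lemma parity_vacuum : exists2 c : R[i], c != 0 & g Om = c *: Om.
Proof.
have E : g Om = dotp Om (g Om) *: Om.
  apply: vacuum_unique => f.
  have -> : f = V (adj V f) + (f - range_proj V f) by rewrite addrC subrK.
  have pd : range_proj V (f - range_proj V f) = 0.
    by rewrite bopBr projM ?subrr //; exact: range_proj_is_proj.
  rewrite annihilationD bopDE -(parity_annihilation_defect pd) annihilation_vacuum linear0 addr0.
  by apply: oppr_inj; rewrite -parity_annihilation_range annihilation_vacuum linear0 oppr0.
exists (dotp Om (g Om)) => //; apply/eqP => c0.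
have := parityK Om; rewrite E c0 scale0r linear0 => /esym/eqP; apply/negP.
exact: vacuum_neq0.
Qed.

End OneEndo.
End FermiEndomorphisms.

(** * Noncommuting elements of the relative commutants for the CAR flow *)

Section FermiNoncommuting.
Context {R : realType} {K : hilbertType R} (G : altFock K).
Implicit Types (f u w : K).

Local Notation "a+ f" := (creation G f) (at level 8, f at level 8).
Local Notation "a- f" := (annihilation G f) (at level 8, f at level 8).
Local Notation Om := (wedge G [::]).

Variable Gam : 'B(G).
Hypothesis hGam : forall s, Gam (wedge G s) = wedge G (map (reflection (bop1 : 'B(K))) s).

(* Let [T] be the second quantization of the reflection that is [-1] on the part
   of [ran W] orthogonal to [ran V] and [1] on its complement. Then [T] commutes
   with [ran phi] and [a+ xi phi(Gam) T] commutes with [ran psi]. *)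
Lemma twisted_creation_commutes (phi psi : 'B(G) -> 'B(G)) (V W : 'B(K)) (xi : K) :
  normal_unital_star_endo phi -> normal_unital_star_endo psi ->
  isometry V -> isometry W ->
  (forall u, phi (a- u) = a- (V u)) -> (forall u, psi (a- u) = a- (W u)) ->
  range_proj V \* range_proj W = range_proj W \* range_proj V ->
  range_proj W xi = 0 ->
  forall Z, range phi Z -> range psi Z ->
    (a+ xi \* phi Gam) \* Z = Z \* (a+ xi \* phi Gam).
Proof.
move=> hphi hpsi hV hW phia psia comm Wxi Z hZ1 hZ2.
have hp := range_proj_is_proj hV; have hq := range_proj_is_proj hW.
have pq x : range_proj V (range_proj W x) = range_proj W (range_proj V x).
  exact: (congr1 (fun A : 'B(K) => A x) comm).
pose Q : 'B(K) := range_proj W - range_proj W \* range_proj V.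
have QE x : Q x = range_proj W x - range_proj W (range_proj V x) by rewrite bopBE.
have hQ : is_proj Q by exact: proj_diff.
have [T hT] := second_quant_exists G hQ.
have TK := second_quantK hQ hT.
have QV u : Q (V u) = 0 by rewrite QE range_proj_id // subrr.
have RV u : reflection Q (V u) = V u by apply: reflection_fixed.
have TphiC : forall A, T \* phi A = phi A \* T.
  apply: (CAR_commutant hphi phia) => u x.
    by rewrite (second_quant_creation hT) RV.
  by rewrite (second_quant_annihilation hQ hT) RV.
have xiW w : dotp xi (W w) = 0 by exact: (defect_dotp hW Wxi).
pose g := parity_image Gam phi.
pose S := a+ xi \* g \* T.
have SE x : S x = a+ xi (g (T x)) by [].
(* [b] is the component of [W w] orthogonal to the range of [V]; both components are orthogonal to
   [xi]. *)
have split_W w : exists u b, [/\ W w = b + V u, Q b = b, range_proj V b = 0,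
    dotp xi b = 0 & dotp xi (V u) = 0].
  exists (adj V (W w)), (Q (W w)).
  have E : Q (W w) = W w - range_proj V (W w).
    by rewrite QE -pq range_proj_id.
  have xQ : dotp xi (Q (W w)) = 0.
    by rewrite QE dotpBr -!(proj_sym _ _ hq) Wxi !dotp0l subrr.
  have WE : W w = Q (W w) + V (adj V (W w)) by rewrite E subrK.
  split=> //; first exact: (projM _ hQ).
    by rewrite E bopBr projM // subrr.
  by have h := xiW w; rewrite WE dotpDr xQ add0r in h.
have Tb b : Q b = b -> forall x, T (a+ b x) = - a+ b (T x).
  by move=> Qb x; rewrite (second_quant_creation hT) reflection_opp // creationN bopNE.
have Tb' b : Q b = b -> forall x, T (a- b x) = - a- b (T x).
  by move=> Qb x; rewrite (second_quant_annihilation hQ hT) reflection_opp // annihilationN bopNE.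
(* Two signs cancel in each case: those of [T] and [a+ xi] on generators from [b], those of [g] and
   [a+ xi] on generators from [V u]. *)
have SpsiC : forall A, S \* psi A = psi A \* S.
  apply: (CAR_commutant hpsi psia) => w x.
    have [u [b [-> Qb pb xb xu]]] := split_W w.
    rewrite creationD !bopDE bopDr; congr (_ + _); rewrite !SE.
      rewrite Tb // !bopNr (parity_creation_defect hGam hphi hV phia pb).
      by rewrite creation_anticomm opprK.
    rewrite (second_quant_creation hT) RV (parity_creation_range hGam hphi phia).
    by rewrite bopNr creation_anticomm opprK.
  have [u [b [-> Qb pb xb xu]]] := split_W w.
  rewrite annihilationD !bopDE bopDr; congr (_ + _); rewrite !SE.
    rewrite Tb' // !bopNr (parity_annihilation_defect hGam hphi hV phia pb).
    by rewrite CAR (dotp0C xb) scale0r sub0r.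
  rewrite (second_quant_annihilation hQ hT) RV (parity_annihilation_range hGam hphi phia).
  by rewrite bopNr CAR (dotp0C xu) scale0r sub0r.
have [A _ ZA] := hZ1; have [B _ ZB] := hZ2.
have TZ x : T (Z x) = Z (T x) by rewrite -ZA; exact: (bop_comm_at (TphiC A)).
have SZ x : S (Z x) = Z (S x) by rewrite -ZB; exact: (bop_comm_at (SpsiC B)).
(* As [T] squares to the identity, [a+ xi \* phi Gam] is [S \* T], and both factors commute with
   [Z]. *)
by apply: bopP => x /=; rewrite -[x in LHS]TK -TZ -/g -SE SZ SE TK.
Qed.

Lemma CAR_not_commuting (phi psi : 'B(G) -> 'B(G)) (V W : 'B(K)) (xi eta : K) :
  normal_unital_star_endo phi -> normal_unital_star_endo psi ->
  isometry V -> isometry W ->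
  (forall u, phi (a- u) = a- (V u)) -> (forall u, psi (a- u) = a- (W u)) ->
  range_proj V \* range_proj W = range_proj W \* range_proj V ->
  xi != 0 -> range_proj V xi = xi -> range_proj W xi = 0 ->
  eta != 0 -> range_proj W eta = eta -> range_proj V eta = 0 ->
  ~ relative_commutants_commute phi psi.
Proof.
move=> hphi hpsi hV hW phia psia comm xi0 Vxi Wxi eta0 Weta Veta hcomm.
have E1 : phi (a+ (adj V xi) \* Gam) = a+ xi \* phi Gam.
  by rewrite (endo_mul hphi) (phic hphi phia) -range_projE Vxi.
have E2 : psi (a+ (adj W eta) \* Gam) = a+ eta \* psi Gam.
  by rewrite (endo_mul hpsi) (phic hpsi psia) -range_projE Weta.
have := hcomm (a+ (adj V xi) \* Gam) (a+ (adj W eta) \* Gam).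
rewrite E1 E2 => h.
have /(congr1 (fun A : 'B(G) => A Om)) /= : (a+ xi \* phi Gam) \* (a+ eta \* psi Gam) =
    (a+ eta \* psi Gam) \* (a+ xi \* phi Gam).
  apply: h => Z Z1 Z2; split.
    exact: (twisted_creation_commutes hphi hpsi hV hW phia psia comm Wxi).
  exact: (twisted_creation_commutes hpsi hphi hW hV psia phia (esym comm) Veta).
have [c c0 hc] := parity_vacuum hGam hphi hV phia.
have [c' c'0 hc'] := parity_vacuum hGam hpsi hW psia.
rewrite -!/(parity_image Gam _) (parity_creation_defect hGam hphi hV phia Veta).
rewrite (parity_creation_defect hGam hpsi hW psia Wxi) hc hc' !bopZr hc hc' !bopZr.
rewrite creation_anticomm !scalerN !scalerA mulrC => /eqP.
rewrite eq_sym -subr_eq0 opprK -scalerDl scaler_eq0.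
rewrite -mulr2n mulrn_eq0 /= mulf_eq0 (negPf c0) (negPf c'0) /= => /eqP h0.
(* Applying [a- eta] and then [a- xi] to [a+ eta (a+ xi Om)] gives a nonzero multiple of the vacuum,
   a contradiction. *)
have := CAR eta eta (a+ xi Om); rewrite h0 linear0.
rewrite CAR annihilation_vacuum linear0 subr0.
have -> : dotp eta xi = 0.
  by rewrite -Weta (proj_sym _ _ (range_proj_is_proj hW)) Wxi dotp0r.
rewrite scale0r linear0 subr0 => /esym/eqP.
rewrite scaler_eq0 dotp_nm (negPf (nm_sqrC_neq0 eta0)) /= => /eqP h1.
have := CAR xi xi Om; rewrite h1 linear0 annihilation_vacuum linear0 subr0 => /esym/eqP.
rewrite scaler_eq0 dotp_nm (negPf (nm_sqrC_neq0 xi0)) (negPf (vacuum_neq0 G)) //.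
Qed.

End FermiNoncommuting.

(** * The complex exponential *)

Section Limits.
Context {R : realType}.

Lemma tends_to_unique {V : normedZmodType R[i]} (u : nat -> V) l l' :
  tends_to u l -> tends_to u l' -> l = l'.
Proof.
move=> h h'; apply/eqP; rewrite -subr_eq0; apply/eqP/nm_le_small => e e0.
have [N hN] := h (e / 2) (ltac:(by rewrite divr_gt0)).
have [N' hN'] := h' (e / 2) (ltac:(by rewrite divr_gt0)).
have := hN _ (leq_maxl N N'); have := hN' _ (leq_maxr N N'); rewrite nm_distC.
set n := maxn N N' => h1; rewrite nm_distC => h2.
have := nm_triangleB l (u n) l'; move: h1 h2; rewrite (nm_distC l'); lra.
Qed.

Lemma tends_to_squeeze {V : normedZmodType R[i]} (u v : nat -> V) (w : nat -> R) l :
  tends_to v l -> w @ \oo --> (0 : R) -> (forall n, nm (u n - v n) <= w n) -> tends_to u l.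
Proof.
move=> hv /cvgrPdist_lt hw huv e e0.
have [N hN] := hv (e / 2) (ltac:(by rewrite divr_gt0)).
have [N' _ hN'] := hw (e / 2) (ltac:(by rewrite divr_gt0)).
exists (maxn N N') => n; rewrite geq_max => /andP[Nn Nn'].
have := hN n Nn; have := hN' n Nn'; rewrite sub0r normrN => h2.
have := nm_triangleB (u n) (v n) l; have := huv n; have := ler_norm (w n).
move: h2; lra.
Qed.

Lemma tends_toM (u v : nat -> R[i]) a b :
  tends_to u a -> tends_to v b -> tends_to (fun n => u n * v n) (a * b).
Proof.
move=> hu hv e e0.
have a0 := nm_ge0 a; have b0 := nm_ge0 b.
have d0 : 0 < nm a + nm b + 1 by lra.
pose d := Num.min 1 (e / (nm a + nm b + 1)).
have dp : 0 < d by rewrite lt_min ltr01 divr_gt0.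
have d1 : d <= 1 by rewrite ge_min lexx.
have de : d * (nm a + nm b + 1) <= e by rewrite -ler_pdivlMr // ge_min lexx orbT.
have [N hN] := hu d dp; have [N' hN'] := hv d dp.
exists (maxn N N') => n; rewrite geq_max => /andP[Nn Nn'].
have -> : u n * v n - a * b = (u n - a) * (v n - b) + (u n - a) * b + a * (v n - b) by ring.
apply: le_lt_trans (nm_triangle _ _) _.
apply: le_lt_trans (lerD (nm_triangle _ _) (lexx _)) _; rewrite !nmM.
have := hN n Nn; have := hN' n Nn'; have := nm_ge0 (u n - a); have := nm_ge0 (v n - b).
set p := nm (u n - a); set q := nm (v n - b) => q0 p0 qd pd.
have : p * q < d by nra.
have : p * nm b <= d * nm b by rewrite ler_wpM2r // ltW.
have : nm a * q <= d * nm a by rewrite mulrC ler_wpM2r // ltW.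
lra.
Qed.

Lemma tends_to_real (u : nat -> R) (l : R) :
  u @ \oo --> l -> tends_to (fun n => (u n)%:C : R[i]) l%:C.
Proof.
move=> /cvgrPdist_lt h e e0; have [N _ hN] := h e e0.
exists N => n Nn; rewrite -rmorphB /= nm_real distrC; exact: hN.
Qed.

Lemma tends_to_complex (u v : nat -> R) (a b : R) : u @ \oo --> a -> v @ \oo --> b ->
  tends_to (fun n => u n +i* v n) (a +i* b).
Proof.
move=> /tends_to_real hu /tends_to_real hv e e0.
have [N hN] := hu (e / 2) (ltac:(by rewrite divr_gt0)).
have [N' hN'] := hv (e / 2) (ltac:(by rewrite divr_gt0)).
exists (maxn N N') => n; rewrite geq_max => /andP[/hN h1 /hN' h2].
have -> : u n +i* v n - (a +i* b) = ((u n)%:C - a%:C) + 'i%C * ((v n)%:C - b%:C).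
  by apply/eqP; rewrite eq_complex /=; apply/andP; split; apply/eqP; ring.
apply: le_lt_trans (nm_triangle _ _) _; rewrite nmM.
have -> : nm ('i%C : R[i]) = 1 by rewrite /nm normc_def /= expr0n expr1n add0r sqrtr1.
lra.
Qed.

End Limits.

Section ComplexExponential.
Context {R : realType}.
Implicit Types (a b z : R[i]) (x y : R).

Definition exp_sum {F : fieldType} (z : F) (n : nat) : F := \sum_(k < n) z ^+ k / k`!%:R.

Lemma exp_sum_real x n : (exp_sum x n)%:C = exp_sum (x%:C : R[i]) n.
Proof.
rewrite /exp_sum rmorph_sum; apply: eq_bigr => k _ /=.
by rewrite fmorph_div rmorphXn rmorph_nat.
Qed.

Lemma exp_sum_expR x : exp_sum x @ \oo --> expR x.
Proof.
have -> : exp_sum x = series (exp_coeff x).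
  by apply/funext => n; rewrite /series /= big_mkord.
exact: is_cvg_series_exp_coeff.
Qed.

(** The formal variable only records degrees: the value at [1] is [exp_sum z n], and below degree
    [n] the product for [a] and [b] has the coefficients for [a + b]. *)
Definition exp_poly {F : fieldType} (z : F) (n : nat) : {poly F} := \poly_(k < n) (z ^+ k / k`!%:R).

Definition exp_tail {F : fieldType} (a b : F) (n : nat) : F :=
  \sum_(n <= k < n + n) (exp_poly a n * exp_poly b n)`_k.

Lemma exp_sumM {F : numFieldType} (a b : F) n :
  exp_sum a n * exp_sum b n = exp_sum (a + b) n + exp_tail a b n.
Proof.
have hE (z : F) : exp_sum z n = (exp_poly z n).[1].
  rewrite (horner_coef_wide (n := n)) ?size_poly //; apply: eq_bigr => k _.
  by rewrite coef_poly ltn_ord expr1n mulr1.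
rewrite !hE -hornerM (horner_coef_wide (n := n + n)); last first.
  apply: leq_trans (size_polyMleq _ _) _.
  by apply: leq_trans (leq_pred _) (leq_add _ _); exact: size_poly.
rewrite -(big_mkord predT (fun i => (exp_poly a n * exp_poly b n)`_i * 1 ^+ i)).
rewrite (big_cat_nat (leq0n n) (leq_addr n n)) /=; congr (_ + _); last first.
  by apply: eq_bigr => k _; rewrite expr1n mulr1.
rewrite -hE /exp_sum big_mkord; apply: eq_bigr => k _; rewrite expr1n mulr1 coefM.
rewrite addrC exprDn mulr_suml; apply: eq_bigr => i _.
have ik : (i <= k)%N by rewrite -ltnS.
rewrite !coef_poly (leq_ltn_trans ik) // (leq_ltn_trans (leq_subr _ _)) //.
rewrite -(bin_fact ik) !natrM -[_ *+ 'C(k, i)]mulr_natr.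
have f0 m : m`!%:R != 0 :> F by rewrite pnatr_eq0 -lt0n fact_gt0.
have b0 : 'C(k, i)%:R != 0 :> F by rewrite pnatr_eq0 -lt0n bin_gt0.
have aux (p q r s t : F) : r != 0 -> s != 0 -> t != 0 ->
  q * p * r / (r * (s * t)) = p / s * (q / t) by move=> r0 s0 t0; field; rewrite r0 s0 t0.
by rewrite aux.
Qed.

(** The tail has nonnegative coefficients in [a] and [b], so a real tail dominates it; real tails
    tend to 0 because [expR] is multiplicative. *)
Lemma nm_exp_tail a b n : nm (exp_tail a b n) <= exp_tail (nm a) (nm b) n.
Proof.
apply: le_trans (nm_sum _ _) _; apply: ler_sum => k _; rewrite !coefM.
apply: le_trans (nm_sum _ _) _; apply: ler_sum => i _; rewrite !coef_poly.
have h z m : nm (if (m < n)%N then z ^+ m / m`!%:R else 0) = (if (m < n)%N then nm z ^+ m / m`!%:R else 0).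
  case: ifP => _; last exact: nm0.
  rewrite nmM nmX -(rmorph_nat (real_complex R)) -fmorphV nm_real ger0_norm ?invr_ge0 //.
by rewrite nmM !h.
Qed.

Lemma exp_tail_cvg x y : exp_tail x y @ \oo --> (0 : R).
Proof.
have -> : exp_tail x y = (fun n => exp_sum x n * exp_sum y n - exp_sum (x + y) n).
  by apply/funext => n; rewrite exp_sumM addrC addKr.
rewrite -(subrr (expR (x + y))) {1}expRD; apply: cvgB; last exact: exp_sum_expR.
by apply: cvgM; exact: exp_sum_expR.
Qed.

(** The parity factors and half-integers are those of [cos_coeff] and [sin_coeff]. *)
Lemma imag_pow y k : (0 +i* y) ^+ k =
  ((~~ odd k)%:R * (-1) ^+ k./2 * y ^+ k) +i* ((odd k)%:R * (-1) ^+ k.-1./2 * y ^+ k).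
Proof.
elim: k => [|k IH]; first by rewrite !expr0 !mul1r mul0r mul0r.
rewrite exprSr IH; apply/eqP; rewrite eq_complex /=; apply/andP.
rewrite negbK uphalf_half; have := odd_double_half k.
case: (odd k) => /= hk; last first.
  by split; apply/eqP; rewrite ?add0n !mul1r !mul0r ?mulr0 ?subr0 // addr0 exprSr mulrA.
rewrite !mul1r !mul0r ?mulr0 ?add0r; split; apply/eqP; last by rewrite ?mulr0 ?mul0r ?add0r.
have -> : k.-1./2 = k./2 by rewrite -{1}hk /= doubleK.
by rewrite add1n exprS exprSr mulN1r mulNr mulrA.
Qed.

Lemma exp_sum_imag y : tends_to (exp_sum (0 +i* y)) (cos y +i* sin y).
Proof.
have hc : series (cos_coeff y) @ \oo --> cos y.
  by rewrite cos.unlock; exact: is_cvg_series_cos_coeff.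
have hs : series (sin_coeff y) @ \oo --> sin y.
  by rewrite sin.unlock; exact: is_cvg_series_sin_coeff.
have -> : exp_sum (0 +i* y) = (fun n => series (cos_coeff y) n +i* series (sin_coeff y) n).
  apply/funext => n; rewrite /series /= !big_mkord /exp_sum.
  elim/big_rec3: _ => // k u v w _ ->; rewrite imag_pow.
  rewrite -(rmorph_nat (real_complex R)) -fmorphV.
  by apply/eqP; rewrite eq_complex /= /cos_coeff /sin_coeff /= -exprnP; apply/andP; split; apply/eqP; ring.
exact: tends_to_complex.
Qed.

(** This is needed because inner products of exponential vectors arise as power series. The partial
    sums for the real and the imaginary part multiply up to an [exp_tail]. *)
Lemma exp_sum_cexp z : tends_to (exp_sum z) (cexp z).
Proof.
have zE : z = (complex.Re z)%:C + (0 +i* complex.Im z).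
  case: z => x y; apply/eqP; rewrite eq_complex /=.
  by apply/andP; split; apply/eqP; ring.
set x := complex.Re z in zE *; set y := complex.Im z in zE *.
apply: (tends_to_squeeze (v := fun n => exp_sum (x%:C : R[i]) n * exp_sum (0 +i* y) n)
  (w := exp_tail (nm (x%:C : R[i])) (nm (0 +i* y)))).
- apply: tends_toM; last exact: exp_sum_imag.
  have := tends_to_real (@exp_sum_expR x).
  rewrite (_ : (fun n => (exp_sum x n)%:C) = exp_sum (x%:C : R[i])) //.
  by apply/funext => n; rewrite exp_sum_real.
- exact: exp_tail_cvg.
move=> n; rewrite exp_sumM -zE opprD addrA subrr add0r nmN; exact: nm_exp_tail.
Qed.

Lemma cexpD a b : cexp (a + b) = cexp a * cexp b.
Proof.
case: a b => [a1 a2] [b1 b2]; rewrite /cexp /= expRD cosD sinD.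
by apply/eqP; rewrite eq_complex /=; apply/andP; split; apply/eqP; ring.
Qed.

Lemma cexp_conj a : cexp (conjc a) = conjc (cexp a).
Proof.
case: a => x y; rewrite /cexp /= cosN sinN.
by apply/eqP; rewrite eq_complex /=; apply/andP; split; apply/eqP; ring.
Qed.

Lemma cexp0 : cexp (0 : R[i]) = 1.
Proof.
rewrite /cexp /= expR0 cos0 sin0.
by apply/eqP; rewrite eq_complex /=; apply/andP; split; apply/eqP; ring.
Qed.

Lemma cexp_neq0 a : cexp a != 0.
Proof.
apply/eqP => h; have := cexp0; rewrite -(subrr a) cexpD h mul0r => /esym/eqP.
by rewrite oner_eq0.
Qed.

Lemma cexp_real x : cexp x%:C = (expR x)%:C :> R[i].
Proof.
rewrite /cexp /= cos0 sin0.
by apply/eqP; rewrite eq_complex /=; apply/andP; split; apply/eqP; ring.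
Qed.

End ComplexExponential.

(** * Exponential vectors and Weyl operators *)

Section ExpVectors.
Context {R : realType} {K : hilbertType R} (G : symFock K).
Implicit Types (u v w : K) (s t : seq K).

Lemma vee_approx (x : G) : approx (lspan (range (vee G))) x.
Proof. exact/dense_approx/vee_total. Qed.

(** All permutations contribute the same product, and their number cancels the normalization. *)
Lemma vee_pow_dotp s n u : dotp (vee G s) (vee G (nseq n u)) =
  if size s == n then \prod_(x <- s) dotp x u else 0.
Proof.
rewrite vee_dotp /sym_gram size_nseq; case: eqP => // <-.
have h (p : 'S_(size s)) : \prod_(i < size s) dotp s`_i (nseq (size s) u)`_(p i) = \prod_(x <- s) dotp x u.
  by rewrite (big_nth 0) big_mkord; apply: eq_bigr => i _; rewrite nth_nseq ltn_ord.
rewrite (eq_bigr _ (fun p _ => h p)) sumr_const card_Sn -[X in _ * X]mulr_natl mulrA.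
by rewrite mulVf ?mul1r // pnatr_eq0 -lt0n fact_gt0.
Qed.

(* Polarization: by Ryser's formula for permanents, [vee s] is a combination of
   tensor powers. *)
Lemma vee_orth (z : G) : (forall n u, dotp z (vee G (nseq n u)) = 0) -> z = 0.
Proof.
move=> hz; apply: (total_orth vee_approx) => _ [s _ <-]; apply: dotp0C.
pose n := size s.
pose w : G := (n`!%:R^-1 : R[i]) *:
  \sum_(A : {set 'I_n}) (-1) ^+ #|~: A| *: vee G (nseq n (\sum_(j in A) s`_j)).
have -> : vee G s = w.
  apply/eqP; rewrite -subr_eq0; apply/eqP/(total_orth vee_approx) => _ [t _ <-].
  apply/eqP; rewrite dotpBr subr_eq0; apply/eqP.
  rewrite vee_dotp /sym_gram /w dotpZr dotp_sumr.
  have [st|st] := eqVneq (size t) (size s); last first.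
    by rewrite big1 ?mulr0 // => A _; rewrite dotpZr vee_pow_dotp (negPf st) mulr0.
  rewrite /n; move: (s) st => s' st; rewrite -st; congr (_ * _).
  rewrite -(ryser (fun i j : 'I_(size t) => dotp t`_i s'`_j)).
  apply: eq_bigr => A _; rewrite dotpZr vee_pow_dotp eqxx; congr (_ * _).
  by rewrite (big_nth 0) big_mkord; apply: eq_bigr => i _; rewrite dotp_sumr.
by rewrite dotpZr dotp_sumr big1 ?mulr0 // => A _; rewrite dotpZr hz mulr0.
Qed.

Definition exp_coef (n : nat) : R[i] := ((Num.sqrt (n`!%:R : R))^-1)%:C.

Lemma exp_coef_sqr n : exp_coef n * exp_coef n = n`!%:R^-1.
Proof.
rewrite -rmorphM /= -invfM -expr2 sqr_sqrtr //.
by rewrite fmorphV rmorph_nat.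
Qed.

Lemma exp_coef_neq0 n : exp_coef n != 0.
Proof.
apply/eqP => h; have := exp_coef_sqr n; rewrite h mul0r => /esym/eqP.
by rewrite invr_eq0 pnatr_eq0 -leqn0 leqNgt fact_gt0.
Qed.

Lemma exp_coef_conj n : conjc (exp_coef n) = exp_coef n.
Proof. exact: conjc_real. Qed.

Definition exp_partial u (n : nat) : G := \sum_(k < n) exp_coef k *: vee G (nseq k u).

Lemma exp_partial_dotp u v n m : (n <= m)%N ->
  dotp (exp_partial u n) (exp_partial v m) = exp_sum (dotp u v) n.
Proof.
move=> nm; rewrite dotp_suml; apply: eq_bigr => k _.
have km : (k < m)%N by apply: leq_trans nm.
rewrite dotp_sumr (bigD1 (Ordinal km)) //= big1 => [|l lk].
  rewrite addr0 dotpZl dotpZr exp_coef_conj mulrA exp_coef_sqr vee_pow_dotp size_nseq eqxx mulrC.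
  by congr (_ * _); rewrite big_nseq -Monoid.iteropE.
rewrite dotpZl dotpZr vee_pow_dotp size_nseq ifN ?mulr0 //.
by apply: contraNneq lk => h; apply/eqP/val_inj.
Qed.

Lemma exp_partial_dist u n m : (n <= m)%N ->
  nm (exp_partial u m - exp_partial u n) ^+ 2 = exp_sum (nm u ^+ 2) m - exp_sum (nm u ^+ 2) n.
Proof.
move=> nm; apply: (@complexI R).
rewrite rmorphB /= !exp_sum_real -!dotp_nm dotpBl !dotpBr.
rewrite (dotp_conj (exp_partial u n) (exp_partial u m)) !exp_partial_dotp // dotp_nm.
rewrite -!exp_sum_real conjc_real.
by ring.
Qed.

Lemma exp_sum_split (x : R) n m : (n <= m)%N ->
  exp_sum x m = exp_sum x n + \sum_(n <= k < m) x ^+ k / k`!%:R.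
Proof.
move=> nm; rewrite /exp_sum -!(big_mkord predT (fun k => x ^+ k / k`!%:R)).
by rewrite (big_cat_nat (leq0n n) nm).
Qed.

Lemma exp_sum_homo (x : R) n m : 0 <= x -> (n <= m)%N -> exp_sum x n <= exp_sum x m.
Proof.
by move=> x0 /exp_sum_split ->; rewrite lerDl sumr_ge0 // => k _; rewrite divr_ge0 ?exprn_ge0.
Qed.

Lemma exp_sum_le (x : R) n : 0 <= x -> exp_sum x n <= expR x.
Proof.
move=> x0; have h := @exp_sum_expR R x.
rewrite -(cvg_lim _ h) //; apply: nondecreasing_cvgn_le; last by apply/cvg_ex; exists (expR x).
by move=> i j; exact: exp_sum_homo.
Qed.

(** So the [limn] in [exp_vector] is a genuine limit: squared distances of partial sums are
    differences of partial sums of a real exponential series. *)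
Lemma exp_partial_tends u : tends_to (exp_partial u) (exp_vector G u).
Proof.
have [|l hl] := @nm_complete R G (exp_partial u).
  move=> e e0; have /tends_to_real/(_ (e ^+ 2 / 2)) := @exp_sum_expR R (nm u ^+ 2).
  case=> [|N hN]; first by rewrite divr_gt0 ?exprn_gt0.
  have aux n m : (N <= n)%N -> (n <= m)%N -> nm (exp_partial u m - exp_partial u n) < e.
    move=> Nn nm_; rewrite -ltr_sqr ?nnegrE ?nm_ge0 ?(ltW e0) // exp_partial_dist //.
    have := hN n Nn; have := hN m (leq_trans Nn nm_).
    rewrite -!rmorphB /= !nm_real.
    set x := exp_sum _ m; set y := exp_sum _ n; set z := expR _.
    have := ler_norm (x - z); have := ler_norm (- (y - z)); rewrite normrN; lra.
  exists N => n m Nn Nm; have [h|h] := leqP n m; last exact: aux (ltnW h).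
  by rewrite nm_distC aux.
suff -> : exp_vector G u = l by [].
rewrite /exp_vector; apply: cvg_lim => //.
have -> : series (fun n => ((Num.sqrt (n`!%:R : R))^-1)%:C *: vee G (nseq n u)) = exp_partial u.
  by apply/funext => n; rewrite /series /= big_mkord.
exact/tends_toP.
Qed.

Lemma tends_to_dotpl (x : G) (f : nat -> G) l : tends_to f l -> tends_to (fun n => dotp (f n) x) (dotp l x).
Proof.
move=> /(tends_to_dotp x) h e /h[N hN]; exists N => n /hN.
by rewrite (dotp_conj x (f n)) (dotp_conj x l) -rmorphB /= nm_conj.
Qed.

Lemma tends_to_near_cst {V : normedZmodType R[i]} (f : nat -> V) l l' N :
  tends_to f l -> (forall n, (N <= n)%N -> f n = l') -> l = l'.
Proof.
move=> h h'; apply: (tends_to_unique h) => e e0; exists N => n /h' ->.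
by rewrite subrr nm0.
Qed.

Lemma exp_partial_exp_dotp u v n : dotp (exp_partial u n) (exp_vector G v) = exp_sum (dotp u v) n.
Proof.
apply: (tends_to_near_cst (N := n) (tends_to_dotp (exp_partial u n) (exp_partial_tends v))).
by move=> m; exact: exp_partial_dotp.
Qed.

Lemma exp_dotp u v : dotp (exp_vector G u) (exp_vector G v) = cexp (dotp u v).
Proof.
apply: (tends_to_unique (tends_to_dotpl _ (exp_partial_tends u))).
under [X in tends_to X _]funext do rewrite exp_partial_exp_dotp.
exact: exp_sum_cexp.
Qed.

Lemma vee_exp_dotp s u : dotp (vee G s) (exp_vector G u) = exp_coef (size s) * \prod_(x <- s) dotp x u.
Proof.
apply: (tends_to_near_cst (N := (size s).+1) (tends_to_dotp (vee G s) (exp_partial_tends u))).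
move=> n sn; rewrite dotp_sumr (bigD1 (Ordinal sn)) //= big1 => [|l ls].
  by rewrite addr0 dotpZr vee_pow_dotp eqxx.
rewrite dotpZr vee_pow_dotp ifN ?mulr0 //.
by apply: contraNneq ls => h; apply/eqP/val_inj.
Qed.

Lemma nm_exp_vector u : nm (exp_vector G u) ^+ 2 = expR (nm u ^+ 2).
Proof. by apply: (@complexI R); rewrite -dotp_nm exp_dotp dotp_nm cexp_real. Qed.

(** In the squared norm, each term of degree at least [n] carries a power of [x] that is at most
    [x ^+ n ^+ 2]. *)
Lemma exp_tail_bound u (x : R) n : 0 <= x <= 1 ->
  nm (exp_vector G (x%:C *: u) - exp_partial (x%:C *: u) n) <= x ^+ n * Num.sqrt (expR (nm u ^+ 2)).
Proof.
move=> /andP[x0 x1]; set w := _ *: u; set B := _ * _.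
apply/ler_addgt0Pr => e e0.
have [N hN] := exp_partial_tends w e0; pose m := maxn N n.
apply: le_trans (nm_triangleB _ (exp_partial w m) _) _.
rewrite addrC lerD //; last by rewrite nm_distC ltW // hN // leq_maxl.
rewrite -ler_sqr ?nnegrE ?nm_ge0 ?mulr_ge0 ?exprn_ge0 ?sqrtr_ge0 //.
rewrite exp_partial_dist ?leq_maxr // exprMn sqr_sqrtr ?expR_ge0 //.
have u0 : 0 <= nm u ^+ 2 by rewrite sqr_ge0.
apply: le_trans (_ : _ <= x ^+ n ^+ 2 * exp_sum (nm u ^+ 2) m) _; last first.
  by rewrite ler_wpM2l ?sqr_ge0 // exp_sum_le.
rewrite !(exp_sum_split _ (leq_maxr N n)) addrAC subrr add0r mulrDr.
apply: ler_wpDl.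
  apply: mulr_ge0; first exact: sqr_ge0.
  by apply: sumr_ge0 => k _; apply: divr_ge0; [exact: exprn_ge0|exact: ler0n].
rewrite mulr_sumr big_nat [X in _ <= X]big_nat; apply: ler_sum => k /andP[nk _].
rewrite /w nmZ nm_real ger0_norm // [(x * _) ^+ 2]exprMn [(_ * _) ^+ k]exprMn [X in _ <= X]mulrA.
apply: ler_wpM2r; first by rewrite invr_ge0.
apply: ler_wpM2r; first exact: exprn_ge0.
rewrite -!exprM; apply: ler_wiXn2l => //.
by rewrite mulnC leq_mul2l nk orbT.
Qed.

(* Comparing the terms of lowest order in [x] of [<z, e(x u)>] as [x -> 0]. *)
Lemma exp_orth (z : G) : (forall u, dotp z (exp_vector G u) = 0) -> z = 0.
Proof.
move=> hz; apply: vee_orth => n u; elim/ltn_ind: n u => n IH u.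
apply: nm_le_small => e e0.
set C := nm z * Num.sqrt (expR (nm u ^+ 2)).
have C0 : 0 <= C by rewrite mulr_ge0 ?nm_ge0 ?sqrtr_ge0.
have c0 : 0 < nm (exp_coef n) by rewrite nm_gt0 exp_coef_neq0.
(* Chosen so that the remainder, of order [x ^+ n.+1], is at most [e] times the coefficient of
   degree [n]; [C + 1] keeps the denominator positive. *)
pose x := Num.min 1 (e * nm (exp_coef n) / (C + 1)).
have x0 : 0 < x by rewrite lt_min ltr01 divr_gt0 ?mulr_gt0 //; lra.
have x1 : x <= 1 by rewrite ge_min lexx.
have xC : x * (C + 1) <= e * nm (exp_coef n).
  by rewrite -ler_pdivlMr ?ge_min ?lexx ?orbT //; lra.
have := exp_tail_bound u n.+1 (x := x); rewrite (ltW x0) x1 => /(_ isT) hb.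
have vZ k (c : R[i]) : dotp z (vee G (nseq k (c *: u))) = c ^+ k * dotp z (vee G (nseq k u)).
  suff -> : vee G (nseq k (c *: u)) = c ^+ k *: vee G (nseq k u) by rewrite dotpZr.
  apply/eqP; rewrite -subr_eq0; apply/eqP/(total_orth vee_approx) => _ [t _ <-].
  rewrite dotpBr dotpZr !vee_pow_dotp; case: eqP => [<-|_]; last by rewrite mulr0 subrr.
  apply/eqP; rewrite subr_eq0; apply/eqP; elim: t => [|y t IHt]; first by rewrite !big_nil mulr1.
  by rewrite !big_cons IHt dotpZr exprS; ring.
(* By induction the terms of degree below [n] vanish, so the remainder pairs with [z] to minus the
   term of degree [n]. *)
have : dotp z (exp_vector G (x%:C *: u) - exp_partial (x%:C *: u) n.+1) =
    - (exp_coef n * (x%:C ^+ n * dotp z (vee G (nseq n u)))).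
  rewrite dotpBr hz sub0r; congr (- _); rewrite dotp_sumr big_ord_recr /= big1 => [|k _].
    by rewrite add0r dotpZr vZ.
  by rewrite dotpZr IH // mulr0.
move=> /(congr1 nm); rewrite nmN !nmM nmX [nm x%:C]nm_real ger0_norm ?(ltW x0) // => hE.
have := cauchy_schwarz z (exp_vector G (x%:C *: u) - exp_partial (x%:C *: u) n.+1).
rewrite hE => hcs.
have xn0 : 0 < x ^+ n by rewrite exprn_gt0.
have h1 : nm (exp_coef n) * (x ^+ n * nm (dotp z (vee G (nseq n u)))) <= x ^+ n * (x * C).
  apply: le_trans hcs _; apply: le_trans (ler_wpM2l (nm_ge0 z) hb) _.
  by rewrite exprS /C le_eqVlt; apply/orP; left; apply/eqP; ring.
move: h1; rewrite mulrCA ler_pM2l // => h1.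
rewrite -(ler_pM2r c0); move: h1 xC x0 => /[!mulrDr]; lra.
Qed.

End ExpVectors.

(** * Weyl operators *)

Section Weyl.
Context {R : realType} {K : hilbertType R} (G : symFock K).
Implicit Types (u v w : K).

Local Notation e := (exp_vector G).

Lemma exp_approx (x : G) : approx (lspan (range e)) x.
Proof.
have [y ay oy] := orth_projection x (lspan_subspace (range e)).
suff -> : x = y by [].
apply/eqP; rewrite -subr_eq0; apply/eqP/exp_orth => u.
by apply: dotp0C; apply: oy; apply: lspan_sub; exists u.
Qed.

Lemma bop_exp_eq (H : hilbertType R) (A B : bop G H) : (forall u, A (e u) = B (e u)) -> A = B.
Proof. by move=> h; apply: (bop_total_eq exp_approx) => _ [u _ <-]. Qed.

Lemma exp_ext (x y : G) : (forall u, dotp (e u) x = dotp (e u) y) -> x = y.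
Proof.
move=> h; apply/eqP; rewrite -subr_eq0; apply/eqP/exp_orth => u.
by apply: dotp0C; rewrite dotpBr h subrr.
Qed.

Definition weyl_factor u v : R[i] := cexp (- (`|u| ^+ 2 / 2) - dotp u v).

Lemma weyl_factorE u v : weyl_factor u v = cexp (- (dotp u u / 2) - dotp u v).
Proof. by rewrite /weyl_factor -dotp_norm. Qed.

Lemma conj_weyl_exponent u v :
  conjc (- (dotp u u / 2) - dotp u v) = - (dotp u u / 2) - dotp v u.
Proof.
rewrite [LHS]rmorphB [X in X - _]rmorphN; congr (- _ - _); last exact/esym/dotp_conj.
rewrite rmorphM; congr (_ * _); first exact/esym/dotp_conj.
by rewrite [LHS]conjc_inv conjc_nat.
Qed.

Lemma weyl_dotp u v w :
  dotp (weyl_factor u v *: e (u + v)) (weyl_factor u w *: e (u + w)) = dotp (e v) (e w).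
Proof.
rewrite dotpZl dotpZr !exp_dotp !weyl_factorE -cexp_conj -!cexpD; congr cexp.
rewrite conj_weyl_exponent !dotpDl !dotpDr.
by field.
Qed.

Lemma weyl_exists u :
  exists T : 'B(G), forall v, T (e v) = weyl_factor u v *: e (u + v).
Proof.
apply: (total_extend (f := fun v => weyl_factor u v *: e (u + v)) ler01 exp_approx) => c.
rewrite mul1r -ler_sqr ?nnegrE ?nm_ge0 // -lecR -!dotp_nm.
rewrite (_ : dotp _ _ = dotp (\sum_(p <- c) p.1 *: e p.2) (\sum_(p <- c) p.1 *: e p.2)) //.
rewrite !dotp_suml; apply: eq_bigr => p _; rewrite !dotp_sumr; apply: eq_bigr => q _.
rewrite [in RHS]dotpZl [in RHS]dotpZr dotpZl; congr (_ * _).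
by rewrite dotpZr weyl_dotp.
Qed.

(** Stated for any operators with the Weyl action, since unitarity must be derived before [weyl] is
    known to satisfy its defining condition. *)
Lemma weyl_ops_adj u (T S : 'B(G)) :
  (forall v, T (e v) = weyl_factor u v *: e (u + v)) ->
  (forall v, S (e v) = weyl_factor (- u) v *: e (- u + v)) -> adj T = S.
Proof.
move=> hT hS; apply: bop_exp_eq => w; apply: exp_ext => v.
rewrite -adjE hT hS dotpZl dotpZr !exp_dotp !weyl_factorE -cexp_conj -!cexpD; congr cexp.
rewrite conj_weyl_exponent !dotpDl !dotpDr !dotpNl !dotpNr.
by ring.
Qed.

(** Orthogonality of [u] and [v] removes the phase from the Weyl relation. *)
Lemma weyl_ops_mul u v (T S W : 'B(G)) : dotp u v = 0 ->
  (forall w, T (e w) = weyl_factor u w *: e (u + w)) ->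
  (forall w, S (e w) = weyl_factor v w *: e (v + w)) ->
  (forall w, W (e w) = weyl_factor (u + v) w *: e (u + v + w)) -> T \* S = W.
Proof.
move=> uv hT hS hW; apply: bop_exp_eq => w; rewrite /= hS bopZr hT hW scalerA addrA.
congr (_ *: _); rewrite !weyl_factorE -cexpD; congr cexp.
by rewrite !dotpDl !dotpDr uv (dotp0C uv); field.
Qed.

Lemma weyl_ops_unitary u (T : 'B(G)) :
  (forall v, T (e v) = weyl_factor u v *: e (u + v)) -> unitary T.
Proof.
move=> hT; have [S hS] := weyl_exists (- u); rewrite /unitary (weyl_ops_adj hT hS).
have k (z w : K) (A B : 'B(G)) : z + w = 0 ->
    (forall v, A (e v) = weyl_factor z v *: e (z + v)) ->
    (forall v, B (e v) = weyl_factor w v *: e (w + v)) -> A \* B = bop1.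
  move=> zw hA hB; apply: bop_exp_eq => v; rewrite /= hB bopZr hA scalerA addrA zw add0r.
  rewrite -[RHS]scale1r; congr (_ *: _); rewrite !weyl_factorE -cexpD -[RHS](@cexp0 R); congr cexp.
  have -> : w = - z by apply/eqP; rewrite -addr_eq0 addrC zw.
  by rewrite !dotpDr !dotpNl !dotpNr; field.
by split; [apply: (k (- u) u)|apply: (k u (- u))] => //; rewrite ?addNr ?subrr.
Qed.

Lemma weylP u : unitary (weyl G u) /\ forall v, weyl G u (e v) = weyl_factor u v *: e (u + v).
Proof.
rewrite /weyl; case: xgetP => [T _ [h1 h2]|h]; first by [].
by have [T hT] := weyl_exists u; case: (h T); split=> //; exact: weyl_ops_unitary hT.
Qed.

Lemma weyl_exp u v : weyl G u (e v) = weyl_factor u v *: e (u + v).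
Proof. by case: (weylP u). Qed.

Lemma adj_weyl u : adj (weyl G u) = weyl G (- u).
Proof. apply: weyl_ops_adj => v; exact: weyl_exp. Qed.

Lemma weylD u v : dotp u v = 0 -> weyl G u \* weyl G v = weyl G (u + v).
Proof. by move=> uv; apply: (weyl_ops_mul uv) => w; exact: weyl_exp. Qed.

Lemma weyl_exp_orth u v : dotp u v = 0 ->
  weyl G u (e v) = cexp (- (dotp u u / 2)) *: e (u + v).
Proof. by move=> uv; rewrite weyl_exp weyl_factorE uv subr0. Qed.

End Weyl.

(** * Constancy of functions that are holomorphic and antiholomorphic *)

Section RootsOfUnity.
Context {C : numClosedFieldType}.

Lemma primitive_root_exists n : (0 < n)%N -> exists z : C, n.-primitive_root z.
Proof.
move=> n0; have [rs rsE] := closed_field_poly_normal ('X^n - 1 : {poly C}).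
rewrite lead_coefDl ?lead_coefXn ?scale1r ?size_polyN ?size_polyXn ?size_poly1 // in rsE.
have unity z : z \in rs -> n.-unity_root z.
  by move=> zrs; rewrite /root_of_unity rsE root_prod_XsubC.
have rs_uniq : uniq rs.
  by rewrite -separable_prod_XsubC -rsE separable_Xn_sub_1 // pnatr_eq0 -lt0n.
have rs_size : (n <= size rs)%N.
  by rewrite -ltnS -(size_prod_XsubC rs id) -rsE size_XnsubC.
have /hasP[z _ hz] := has_prim_root n0 (introT allP unity) rs_uniq rs_size.
by exists z.
Qed.

Lemma sum_unity_root n (x : C) : x != 1 -> x ^+ n = 1 -> \sum_(k < n) x ^+ k = 0.
Proof.
move=> x1 xn; have := subrX1 x n; rewrite xn subrr => /esym/eqP.
by rewrite mulf_eq0 subr_eq0 (negPf x1) /= => /eqP.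
Qed.

End RootsOfUnity.

Section HolomorphicAntiholomorphic.
Context {R : realType}.
Implicit Types (p q : {poly R[i]}).

(* The averages over [k < m] of [w^(-k n) f(2 w^k)], where [w] is a primitive
   [m]-th root of unity, are [p_n 2^n] for [f = p] and [0] for [f = conj q]. *)
Lemma coef_conj_bound p q (e : R) n : (0 < n)%N ->
  (forall z : R[i], nm z <= 2 -> nm (p.[z] - conjc q.[z]) <= e) ->
  nm p`_n * 2 ^+ n <= e.
Proof.
(* This [m] excludes aliasing: for the exponents [j] involved, [j - n] is a multiple of [m] only for
   [j = n], and [n + j] never is, as [n] is positive. *)
move=> n0 hpq; pose m := (n + size p + size q).+1.
have [w hw] := @primitive_root_exists R[i] m isT.
have wm : w ^+ m = 1 by exact: prim_expr_order.
have w1 : nm w = 1.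
  by apply/eqP; rewrite -(@pexpr_eq1 _ _ m) ?nm_ge0 // -nmX wm nm1.
have ww : w * conjc w = 1 by rewrite nm_sqr w1 expr1n.
have w'm : conjc w ^+ m = 1 by rewrite -rmorphXn wm rmorph1.
have nw k : nm (2%:R * w ^+ k : R[i]) <= 2.
  rewrite nmM nmX w1 expr1n mulr1 -(rmorph_nat (real_complex R)) nm_real normr_nat //.
have hp : \sum_(k < m) (conjc w) ^+ (k * n) * p.[2%:R * w ^+ k] = m%:R * (p`_n * 2%:R ^+ n).
  have pE z : p.[z] = \sum_(j < m) p`_j * z ^+ j.
    by apply: horner_coef_wide; exact: leqW (leq_trans (leq_addl n _) (leq_addr _ _)).
  under eq_bigr do rewrite pE mulr_sumr.
  rewrite exchange_big /=.
  have nm' : (n < m)%N by rewrite /m ltnS -addnA leq_addr.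
  rewrite (bigD1 (Ordinal nm')) //= [X in _ + X]big1 => [|j jn].
    rewrite addr0 (eq_bigr (fun _ => p`_n * 2%:R ^+ n)) => [|k _].
      by rewrite sumr_const card_ord mulr_natl.
    rewrite exprMn -exprM mulrCA; congr (_ * _); rewrite mulrCA -exprMn [conjc w * w]mulrC ww expr1n mulr1 //.
  rewrite (eq_bigr (fun k : 'I_m => p`_j * 2%:R ^+ j * (conjc w ^+ n * w ^+ j) ^+ k)) => [|k _].
    rewrite -mulr_sumr sum_unity_root ?mulr0 //.
      apply: contraNneq jn => h.
      have : w ^+ n == w ^+ j.
        by rewrite -[X in _ == X]mul1r -(expr1n _ n) -ww exprMn -mulrA h mulr1.
      rewrite (eq_prim_root_expr hw) !modn_small ?ltn_ord // => /eqP nj.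
      by apply/eqP/val_inj.
    by rewrite exprMn -!exprM ![(_ * m)%N]mulnC !exprM w'm wm !expr1n mulr1.
  by rewrite !exprMn -!exprM [(n * k)%N]mulnC [(j * k)%N]mulnC; ring.
have hq : \sum_(k < m) (conjc w) ^+ (k * n) * conjc q.[2%:R * w ^+ k] = 0.
  transitivity (conjc (\sum_(k < m) w ^+ (k * n) * q.[2%:R * w ^+ k])).
    rewrite rmorph_sum; apply: eq_bigr => k _; rewrite rmorphM; congr (_ * _).
    by rewrite -rmorphXn.
  have qE z : q.[z] = \sum_(j < size q) q`_j * z ^+ j by exact: horner_coef.
  under eq_bigr do rewrite qE mulr_sumr.
  rewrite exchange_big /= big1 ?rmorph0 // => j _.
  rewrite (eq_bigr (fun k : 'I_m => q`_j * 2%:R ^+ j * (w ^+ (n + j)) ^+ k)) => [|k _].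
    rewrite -mulr_sumr sum_unity_root ?mulr0 //.
      rewrite -(prim_order_dvd hw); apply/negP => /dvdn_leq; rewrite addn_gt0 n0 => /(_ isT).
      by apply/negP; rewrite -ltnNge /m ltnS leq_add ?leq_addr // ltnW.
    by rewrite -exprM mulnC exprM wm expr1n.
  by rewrite !exprMn -!exprM mulnDl exprD [(n * k)%N]mulnC [(j * k)%N]mulnC; ring.
have m0 : (0 : R) < m%:R by rewrite ltr0n.
rewrite -(ler_pM2l m0).
have -> : m%:R * (nm p`_n * 2 ^+ n) =
    nm (\sum_(k < m) (conjc w) ^+ (k * n) * (p.[2%:R * w ^+ k] - conjc q.[2%:R * w ^+ k])).
  under eq_bigr do rewrite mulrBr.
  rewrite big_split /= sumrN hp hq subr0 !nmM nmX -!(rmorph_nat (real_complex R)) !nm_real !normr_nat //.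
apply: le_trans (nm_sum _ _) _.
rewrite mulr_natl -[X in _ <= e *+ X]card_ord -sumr_const; apply: ler_sum => k _.
by rewrite nmM nmX nm_conj w1 expr1n mul1r hpq.
Qed.

(** Radius 2 makes the bounds on the coefficients of positive degree geometric, with sum at most
    [e]. *)
Lemma poly_conj_bound p q (e : R) :
  (forall z : R[i], nm z <= 2 -> nm (p.[z] - conjc q.[z]) <= e) ->
  nm (p.[1] - p.[0]) <= e.
Proof.
move=> hpq.
have e0 : 0 <= e by apply: le_trans (hpq 0 _); rewrite ?nm_ge0 // nm0.
rewrite horner_coef0 (horner_coef_wide (n := (size p).+1)) // big_ord_recl expr1n mulr1 addrC addKr.
apply: le_trans (nm_sum _ _) _.
apply: le_trans (_ : _ <= \sum_(i < size p) e * 2^-1 ^+ i.+1) _.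
  apply: ler_sum => i _; rewrite expr1n mulr1 exprVn ler_pdivlMr ?exprn_gt0 //.
  by apply: (coef_conj_bound (q := q)) hpq.
rewrite -mulr_sumr ler_piMr //.
have : forall N, \sum_(i < N) (2^-1 : R) ^+ i.+1 = 1 - 2^-1 ^+ N.
  elim=> [|N IH]; first by rewrite big_ord0 expr0 subrr.
  by rewrite big_ord_recr /= IH exprS; field.
by move=> ->; rewrite lerBlDr lerDl exprn_ge0.
Qed.

(** Uniform polynomial approximation on the disc of radius 2, in place of holomorphy. *)
Definition poly_approx (g : R[i] -> R[i]) : Prop := forall e : R, 0 < e ->
  exists p : {poly R[i]}, forall z, nm z <= 2 -> nm (g z - p.[z]) <= e.

Lemma poly_approx_conj_const g : poly_approx g -> poly_approx (fun z => conjc (g z)) -> g 1 = g 0.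
Proof.
move=> hg hg'; apply/eqP; rewrite -subr_eq0; apply/eqP/nm_le_small => e e0.
have e4 : 0 < e / 4 by rewrite divr_gt0.
have [p hp] := hg _ e4; have [q hq] := hg' _ e4.
have : nm (p.[1] - p.[0]) <= e / 4 + e / 4.
  apply: (poly_conj_bound (q := q)) => z z2.
  apply: le_trans (nm_triangleB _ (g z) _) _.
  apply: lerD; first by rewrite nm_distC hp.
  by rewrite -nm_conj rmorphB /= conjcK hq.
have h1 := hp 1; have h0 := hp 0; rewrite nm1 nm0 in h1 h0.
have := h1 (ltac:(lra)); have := h0 (ltac:(lra)).
have := nm_triangleB (g 1) p.[1] (g 0); have := nm_triangleB p.[1] p.[0] (g 0).
rewrite (nm_distC (g 0)); lra.
Qed.

End HolomorphicAntiholomorphic.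

(** * Commutation for the CCR flow *)

Section Haag.
Context {R : realType} {K : hilbertType R} (G : symFock K).
Implicit Types (u v w : K).

Local Notation e := (exp_vector G).
Local Notation W := (weyl G).

(** Against a decomposable vector, an exponential vector gives a product of affine functions of [z];
    the norms of the exponential vectors are uniformly bounded on the disc. *)
Lemma exp_poly_approx (x : G) w u : poly_approx (fun z => dotp x (e (w + z *: u))).
Proof.
move=> d d0; pose B := Num.sqrt (expR ((nm w + 2 * nm u) ^+ 2)).
have B0 : 0 <= B by rewrite sqrtr_ge0.
have hB z : nm z <= 2 -> nm (e (w + z *: u)) <= B.
  move=> z2; rewrite -ler_sqr ?nnegrE ?nm_ge0 // nm_exp_vector sqr_sqrtr ?expR_ge0 //.
  rewrite ler_expR ler_sqr ?nnegrE ?nm_ge0 ?addr_ge0 ?mulr_ge0 ?nm_ge0 //.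
  by apply: le_trans (nm_triangle _ _) _; rewrite lerD2l nmZ ler_wpM2r ?nm_ge0.
have B1 : 0 < B + 1 by rewrite ltr_wpDl.
have [y hy xy] := vee_approx x (divr_gt0 d0 B1).
have [p hp] : exists p : {poly R[i]}, forall z, dotp y (e (w + z *: u)) = p.[z].
  move: y hy {xy}; apply: lspan_min.
    split; first by exists 0 => z; rewrite dotp0l horner0.
    move=> a y y' [p hp] [p' hp']; exists ((conjc a)%:P * p + p') => z.
    by rewrite dotpDl dotpZl hp hp' hornerD hornerM hornerC.
  move=> _ [s _ <-].
  exists ((exp_coef (R := R) (size s))%:P * \prod_(y <- s) ((dotp y w)%:P + (dotp y u)%:P * 'X)) => z.
  rewrite vee_exp_dotp hornerM hornerC horner_prod; congr (_ * _); apply: eq_bigr => y _.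
  by rewrite dotpDr dotpZr hornerD hornerM !hornerC hornerX mulrC [X in _ + X]mulrC addrC.
exists p => z z2; rewrite -hp -dotpBl.
apply: le_trans (cauchy_schwarz _ _) _.
move: xy; rewrite ltr_pdivlMr // => xy.
have := hB z z2; have := nm_ge0 (x - y); have := nm_ge0 (e (w + z *: u)).
move: xy; nra.
Qed.

(* Both [z => <Y* e(v), e(v' - z u)>] and its conjugate [z => <Y e(v'), e(v + z u)>]
   are locally uniform limits of polynomials, so the function is constant. *)
Lemma weyl_commutant_const (Y : 'B(G)) u v v' : dotp u v = 0 -> dotp u v' = 0 ->
  (forall z : R[i], Y \* W (z *: u) = W (z *: u) \* Y) ->
  dotp (e (v + u)) (Y (e v')) = dotp (e v) (Y (e v')).
Proof.
move=> uv uv' hY.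
pose g z := dotp (adj Y (e v)) (e (v' + z *: (- u))).
have gE z : g z = dotp (e (v + z *: u)) (Y (e v')).
  have o1 : dotp (z *: u) v = 0 by rewrite dotpZl uv mulr0.
  have o2 : dotp (z *: - u) v' = 0 by rewrite dotpZl dotpNl uv' oppr0 mulr0.
  (* Orthogonality makes both Weyl factors equal to this real number, which then cancels. *)
  pose k := cexp (- (dotp (z *: u) (z *: u) / 2)) : R[i].
  have k0 : k != 0 := cexp_neq0 _.
  have kr : conjc k = k.
    by rewrite -cexp_conj; congr cexp; have := conj_weyl_exponent (z *: u) 0; rewrite dotp0r dotp0l subr0.
  have E1 : W (z *: u) (e v) = k *: e (v + z *: u) by rewrite weyl_exp_orth // addrC.
  have E2 : W (z *: - u) (e v') = k *: e (v' + z *: - u).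
    by rewrite weyl_exp_orth // addrC scalerN dotpNl dotpNr opprK.
  apply: (mulfI k0); rewrite /g -dotpZr -E2 -{1}kr -dotpZl -E1 [RHS]adjE adj_weyl [LHS]adjE' -scalerN.
  have := hY (- z); rewrite scaleNr -scalerN => h.
  by congr (dotp _ _); exact: (congr1 (fun A : 'B(G) => A (e v')) h).
have := poly_approx_conj_const (g := g) (exp_poly_approx _ _ _).
rewrite !gE scale1r scale0r addr0; apply.
have -> : (fun z => conjc (g z)) = (fun z => dotp (Y (e v')) (e (v + z *: u))).
  by apply/funext => z; rewrite gE -dotp_conj.
exact: exp_poly_approx.
Qed.

(* [X] maps the vacuum [e 0] to a multiple of itself. *)
Lemma weyl_irreducible : irreducible (range W).
Proof.
move=> X hX; have hXW u : X \* W u = W u \* X by apply: hX; exists u.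
have X0 : X (e 0) = dotp (e 0) (X (e 0)) *: e 0.
  apply: exp_ext => u; have := @weyl_commutant_const X u 0 0 (dotp0r _) (dotp0r _) (fun z => hXW _).
  by rewrite add0r dotpZr exp_dotp dotp0r cexp0 mulr1.
set l := dotp (e 0) _ in X0; exists l; apply: bop_exp_eq => u; rewrite bopZE /=.
have h := weyl_exp_orth G (dotp0r u); rewrite addr0 in h.
apply: (scalerI (cexp_neq0 (- (dotp u u / 2)))).
rewrite -bopZr -h [LHS](congr1 (fun A : 'B(G) => A (e 0)) (hXW u)) /= X0 bopZr h.
by rewrite !scalerA mulrC.
Qed.

(** By [weyl_commutant_const], the inner product of [e w] with [Z (e v)] depends only on [w - P w].
    The same holds with the projection of [Z (e v)] onto the closed span in place of [Z (e v)], so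
    the residual is orthogonal to all exponential vectors. *)
Lemma commutant_vacuum_approx (P : 'B(K)) (Z : 'B(G)) : is_proj P ->
  (forall u, P u = u -> Z \* W u = W u \* Z) ->
  forall v, P v = 0 -> approx (lspan [set x | exists2 v, P v = 0 & x = e v]) (Z (e v)).
Proof.
move=> hP hZ v Pv; set S := lspan _.
have [y ay oy] := orth_projection (Z (e v)) (lspan_subspace [set x | exists2 v, P v = 0 & x = e v]).
suff -> : Z (e v) = y by [].
apply/eqP; rewrite -subr_eq0; apply/eqP/exp_orth => w; apply: dotp0C.
pose u := P w; pose w' := w - u.
have Pu : P u = u by rewrite projM.
have Pw' : P w' = 0 by rewrite bopBr Pu subrr.
have orth x : P x = 0 -> dotp u x = 0 by move=> Px; rewrite -Pu proj_sym // Px dotp0r.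
have Se x : P x = 0 -> S (e x) by move=> Px; apply: lspan_sub; exists x.
have h1 : dotp (e w) (Z (e v)) = dotp (e w') (Z (e v)).
  have := @weyl_commutant_const Z u w' v (orth _ Pw') (orth _ Pv) _.
  rewrite subrK; apply => z; apply: hZ; by rewrite bopZr Pu.
have h2 : dotp (e w) y = dotp (e w') y.
  apply/eqP; rewrite -subr_eq0 -dotpBl; apply/eqP/dotp0C.
  apply: (approx_dotp0 ay) => s; apply: (lspan_min (T := [set s | dotp s (e w - e w') = 0])).
    split=> [|a x x' /= hx hx']; first exact: dotp0l.
    by rewrite dotpDl dotpZl hx hx' mulr0 addr0.
  move=> _ [x Px ->] /=; rewrite dotpBr !exp_dotp.
  by rewrite -[w in LHS](subrK u) dotpDr (dotp0C (orth _ Px)) addr0 subrr.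
by rewrite dotpBr h1 h2 -dotpBr oy //; exact: Se.
Qed.

Lemma weyl_dotp_split (Q : 'B(K)) s t u v : is_proj Q -> Q s = s -> Q u = u -> Q t = 0 -> Q v = 0 ->
  dotp (e (s + t)) (W u (e v)) = dotp (e s) (W u (e 0)) * dotp (e t) (e v).
Proof.
move=> hQ Qs Qu Qt Qv.
have orthQ x y : Q x = x -> Q y = 0 -> dotp x y = 0.
  by move=> <- Qy; rewrite proj_sym // Qy dotp0r.
rewrite !weyl_exp_orth ?dotp0r //; last exact: orthQ.
rewrite !dotpZr !exp_dotp addr0 -mulrA; congr (_ * _); rewrite -cexpD; congr cexp.
rewrite !dotpDl !dotpDr (orthQ _ _ Qs Qv) (dotp0C (orthQ _ _ Qu Qt)).
by rewrite addr0 add0r.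
Qed.

Lemma approx_functional (S : set G) (a b y : G) (c : R[i]) : approx (lspan S) y ->
  (forall s, S s -> dotp a s = c * dotp b s) -> dotp a y = c * dotp b y.
Proof.
move=> Sy h; apply/eqP; rewrite -subr_eq0 -[c]conjcK -dotpZl -dotpBl; apply/eqP/dotp0C.
apply: (approx_dotp0 Sy); apply: (lspan_min (T := [set s | dotp s (a - conjc c *: b) = 0])).
  split=> [|k x x' /= hx hx']; first exact: dotp0l.
  by rewrite dotpDl dotpZl hx hx' mulr0 addr0.
by move=> s Ss; apply: dotp0C; rewrite dotpBl dotpZl conjcK h // subrr.
Qed.

Lemma proj_compl (Q : 'B(K)) : is_proj Q -> is_proj (bop1 - Q).
Proof. by move=> hQ; rewrite -{1}(bop1M Q); apply: proj_diff => //; [exact: proj1|rewrite bop1M bopM1]. Qed.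

Lemma proj_compl_fixed (Q : 'B(K)) u : (bop1 - Q : 'B(K)) u = u <-> Q u = 0.
Proof.
rewrite bopBE; split=> [/eqP|->]; last by rewrite subr0.
by rewrite subr_eq -subr_eq0 opprD addrA subrr sub0r oppr_eq0 => /eqP.
Qed.

Lemma proj_compl_ker (Q : 'B(K)) u : (bop1 - Q : 'B(K)) u = 0 <-> Q u = u.
Proof.
rewrite bopBE; split=> [/eqP|->]; last by rewrite subrr.
by rewrite subr_eq0 => /eqP.
Qed.

(** In the tensor picture, [e (s + t)] is the product of [e s] and [e t], [W u y] is that of
    [W u (e 0)] and [y], and [X] acts on the first factor only. *)
Lemma commutant_matrix_element (Q : 'B(K)) (X : 'B(G)) s t u y : is_proj Q ->
  (forall v, Q v = 0 -> X \* W v = W v \* X) ->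
  Q s = s -> Q u = u -> Q t = 0 ->
  approx (lspan [set x | exists2 v, Q v = 0 & x = e v]) y ->
  dotp (e (s + t)) (X (W u y)) = dotp (e s) (X (W u (e 0))) * dotp (e t) y.
Proof.
move=> hQ hX Qs Qu Qt ay.
have hQ' := proj_compl hQ.
have ax : approx (lspan [set x | exists2 v, Q v = v & x = e v]) (X (e u)).
  have -> : [set x | exists2 v, Q v = v & x = e v] =
      [set x | exists2 v, (bop1 - Q : 'B(K)) v = 0 & x = e v].
    by apply/seteqP; split=> x [v hv xE]; exists v => //; apply/proj_compl_ker.
  apply: commutant_vacuum_approx => //; last exact/proj_compl_ker.
  by move=> v /proj_compl_fixed; exact: hX.
(* Both sides are continuous and linear in [y], so [y] may be an exponential vector [e v]; after
   [W v] is moved past [X], the same reduction applies to [X (e u)]. *)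
rewrite -[X (W u y)]/((X \* W u) y) -adjE'.
apply: approx_functional ay _ => _ [v Qv ->]; rewrite adjE' /=.
pose k := cexp (- (dotp v v / 2)) : R[i]; have k0 : k != 0 := cexp_neq0 _.
have uv : dotp u v = 0 by rewrite -Qu proj_sym // Qv dotp0r.
have vE : W v (e 0) = k *: e v by rewrite weyl_exp_orth ?dotp0r // addr0.
apply: (mulfI k0); rewrite -[LHS]dotpZr -!bopZr -vE mulrCA -[X in _ * X]dotpZr -vE.
have -> : X (W u (W v (e 0))) = W v (X (W u (e 0))).
  rewrite -[W u (W v _)]/((W u \* W v) (e 0)) weylD // addrC -weylD; last exact: dotp0C.
  exact: (congr1 (fun A : 'B(G) => A (W u (e 0))) (hX v Qv)).
rewrite weyl_exp_orth ?dotp0r // addr0 !bopZr; set l := cexp _; rewrite !dotpZr -[RHS]mulrA; congr (l * _).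
rewrite mulrC -adjE'; apply: approx_functional ax _ => _ [w Qw ->]; rewrite adjE'.
rewrite addrC; apply: (weyl_dotp_split hQ'); try exact/proj_compl_fixed; exact/proj_compl_ker.
Qed.

(* A substitute for Haag duality: [X] acts on the first factor of
   [Gamma(ran Q) (x) Gamma(ker Q)] and [Y] on the second one. *)
Lemma commutants_commute (Q : 'B(K)) (X Y : 'B(G)) : is_proj Q ->
  (forall v, Q v = 0 -> X \* W v = W v \* X) ->
  (forall u, Q u = u -> Y \* W u = W u \* Y) -> X \* Y = Y \* X.
Proof.
move=> hQ hX hY; have hQ' := proj_compl hQ.
have hY' v : (bop1 - Q : 'B(K)) v = 0 -> Y \* W v = W v \* Y.
  by move=> /proj_compl_ker; exact: hY.
have hX' v : (bop1 - Q : 'B(K)) v = v -> X \* W v = W v \* X.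
  by move=> /proj_compl_fixed; exact: hX.
apply: bop_exp_eq => w; apply: exp_ext => r /=.
pose u := Q w; pose v := w - u; pose s := Q r; pose t := r - s.
have Qu : Q u = u by rewrite projM.
have Qv : Q v = 0 by rewrite bopBr Qu subrr.
have Qs : Q s = s by rewrite projM.
have Qt : Q t = 0 by rewrite bopBr Qs subrr.
have uv : dotp u v = 0 by rewrite -Qu proj_sym // Qv dotp0r.
pose k (x : K) := cexp (- (dotp x x / 2)) : R[i]; have k0 x : k x != 0 := cexp_neq0 _.
have wE : W u (e v) = k u *: e w by rewrite weyl_exp_orth // addrC subrK.
have vE x : W x (e 0) = k x *: e x by rewrite weyl_exp_orth ?dotp0r // addr0.
have -> : r = s + t by rewrite addrC subrK.
apply: (mulfI (k0 u)); rewrite -!dotpZr -!bopZr -wE.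
have YW : Y (W u (e v)) = W u (Y (e v)).
  exact: (congr1 (fun A : 'B(G) => A (e v)) (hY u Qu)).
(* The matrix element of [X \* Y] factors; with [bop1 - Q] in place of [Q], that of [Y \* X] factors
   into the same two numbers. *)
rewrite YW (commutant_matrix_element hQ hX Qs Qu Qt); last first.
  exact: (commutant_vacuum_approx hQ hY Qv).
apply: (mulfI (k0 v)); rewrite -[RHS]dotpZr -!bopZr -vE.
have -> : X (W u (W v (e 0))) = W v (X (W u (e 0))).
  rewrite -[W u (W v _)]/((W u \* W v) (e 0)) weylD // addrC -weylD; last exact: dotp0C.
  exact: (congr1 (fun A : 'B(G) => A (W u (e 0))) (hX v Qv)).
rewrite [s + t]addrC (commutant_matrix_element hQ' hY' (s := t) (t := s) (u := v)).
- by rewrite !vE !bopZr !dotpZr; ring.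
- exact/proj_compl_fixed.
- exact/proj_compl_fixed.
- exact/proj_compl_ker.
rewrite vE bopZr.
have := commutant_vacuum_approx hQ' hX' (v := u) (iffRL (proj_compl_ker Q u) Qu).
move=> h d d0; have k1 : 0 < nm (k u) by rewrite nm_gt0.
have [z hz zd] := h (d / nm (k u)) (divr_gt0 d0 k1).
exists (k u *: z); first by apply: subspaceZ => //; exact: lspan_subspace.
by rewrite -scalerBr nmZ mulrC -ltr_pdivlMr.
Qed.

(** * The invariant for the CCR flow *)

Section CCRCommute.
Variables (phi psi : 'B(G) -> 'B(G)) (V U : 'B(K)).
Hypotheses (hphi : normal_unital_star_endo phi) (hpsi : normal_unital_star_endo psi).
Hypotheses (hV : isometry V) (hU : isometry U).
Hypothesis phiW : forall u, phi (W u) = W (V u).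
Hypothesis psiW : forall u, psi (W u) = W (U u).
Hypothesis comm : range_proj V \* range_proj U = range_proj U \* range_proj V.

Lemma weyl_defect_comm (phi' : 'B(G) -> 'B(G)) (V' : 'B(K)) u :
  normal_unital_star_endo phi' -> isometry V' -> (forall w, phi' (W w) = W (V' w)) ->
  range_proj V' u = 0 -> forall A, W u \* phi' A = phi' A \* W u.
Proof.
move=> h' hV' h pu; apply: (endo_commutant h' weyl_irreducible) => _ [w _ <-].
have uw := defect_dotp hV' pu w.
by rewrite h !weylD // ?(dotp0C uw) // addrC.
Qed.

Lemma CCR_commuting : relative_commutants_commute phi psi.
Proof.
move=> S T hST.
have hp := range_proj_is_proj hV; have hq := range_proj_is_proj hU.
have pq x : range_proj V (range_proj U x) = range_proj U (range_proj V x).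
  exact: (congr1 (fun A : 'B(K) => A x) comm).
pose Q : 'B(K) := range_proj V - range_proj V \* range_proj U.
have QE x : Q x = range_proj V x - range_proj V (range_proj U x) by rewrite bopBE.
have hQ : is_proj Q by exact: (proj_diff hq hp (esym comm)).
apply: (commutants_commute hQ) => u Qu; last first.
  apply/esym/(weyl_defect_comm hpsi hU psiW).
  by rewrite -Qu QE bopBr -!pq projM ?subrr.
pose a := u - range_proj V u; pose b := range_proj V (range_proj U u).
have pa : range_proj V a = 0 by rewrite bopBr projM // subrr.
have ab : dotp a b = 0 by rewrite /b -proj_sym // pa dotp0l.
have uE : u = a + b.
  have /eqP := Qu; rewrite QE subr_eq0 => /eqP pu.
  by rewrite /b -pu subrK.
rewrite uE -weylD // bopMA -(weyl_defect_comm hphi hV phiW pa) -!bopMA; congr (_ \* _).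
(* Because the projections commute, [b] is both [V] of a vector and [U] of a vector, so [W b] lies
   in both ranges. *)
have b1 : range phi (W b) by exists (W (adj V (range_proj U u))); rewrite ?phiW.
have b2 : range psi (W b).
  by exists (W (adj U (range_proj V u))); rewrite // psiW -range_projE /b pq.
by have [] := hST (W b) b1 b2.
Qed.

End CCRCommute.
End Haag.

Theorem proposition5p2 (R : realType) (d : nat) (P : set 'rV[R]_d)
    (K : hilbertType R) (V : 'rV[R]_d -> 'B(K))
    (Gs : symFock K) (Ga : altFock K)
    (alpha : 'rV[R]_d -> 'B(Gs) -> 'B(Gs))
    (beta : 'rV[R]_d -> 'B(Ga) -> 'B(Ga)) :
  closed_convex_cone P -> spanning P -> pointed_cone P ->
  separable K ->
  isometric_rep P V -> pure P V -> proper_rep P V ->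
  CCR_flow P V alpha -> CAR_flow P V beta ->
  ~ cocycle_conjugate P alpha beta.
Proof.
move=> [_ _ PD _] _ _ _ hV _ [x [y [Px Py]]] /= [neA neB orthAB].
move=> [hal halW] [hbe hbea] cc.
have hVx := rep_isometry hV Px; have hVy := rep_isometry hV Py.
have VV : V x \* V y = V y \* V x by rewrite -!(repD hV) // addrC.
have comm := proper_range_proj_comm hVx hVy VV orthAB.
have [xi xi0 [Vxi Wxi]] := proper_range_proj_witness hVx hVy VV orthAB neA.
(* The second witness comes from the same lemma with [x] and [y] exchanged, for which the
   intersection must be written in the other order. *)
have LC := setIC (V y @` defect_space V x) (V x @` defect_space V y).
have orthBA := fun a b ha hb => dotp0C (orthAB b a hb ha).
rewrite -LC in orthBA neB.
have [eta eta0 [Weta Veta]] := proper_range_proj_witness hVy hVx (esym VV) orthBA neB.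
have [Gam hGam] := second_quant_exists Ga (proj1 (H := K)).
apply: (CAR_not_commuting hGam (E0_endo hbe Px) (E0_endo hbe Py) hVx hVy _ _ comm
  xi0 Vxi Wxi eta0 Weta Veta).
- by move=> u; exact: hbea.
- by move=> u; exact: hbea.
apply: (cocycle_conjugate_commutants Px Py (PD _ _ Px Py) hal hbe cc).
apply: (CCR_commuting (E0_endo hal Px) (E0_endo hal Py) hVx hVy _ _ comm).
- by move=> u; exact: halW.
- by move=> u; exact: halW.
Qed.
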